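(* Consider the multi-server speed-scaling problem described in the context, with a power function $P$ satisfying: (A1) $P:\mathbb{R}_+\to\mathbb{R}_+$, $P(0)=0$, $P$ is differentiable, strictly increasing and strictly convex, and $\bar{s}:=\inf\{s>0 : P(s)>s\}<\infty$; (A2) $P(xy)\le P(x)P(y)$ for all $x,y>0$. Consider the online algorithm that at every time $t$ serves, on $\min\{m,n(t)\}$ distinct servers, the $\min\{m,n(t)\}$ unfinished jobs with the shortest remaining sizes (SRPT, with migration allowed), where $n(t)$ is the number of unfinished jobs at time $t$; each busy server runs at speed $P^{-1}(n(t)/m)$ if $n(t)\ge m$ and at speed $P^{-1}(1)$ if $n(t)<m$, and idle servers run at speed $0$. Then this algorithm is $c$-competitive, where $$c = P(2-1/m)\left(2+\frac{2}{P^{-1}(1)}\max(1,P(\bar{s}))\right).$$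
   Context: There are $m$ identical servers, each of which can run at any speed $s\ge 0$ at power consumption $P(s)$; work is processed at rate $s$. A (finite) input instance $\sigma$ consists of jobs $j$ with release times $a_j$ and sizes $w_j>0$. Preemption is allowed, and migration is allowed (a preempted job may be resumed on any server), but a job may be processed by at most one server at any time. Job $j$ completes at time $c_j$ when $w_j$ units of work have been done on it. The cost of a schedule is $C=\int n(t)\,dt+\int\sum_{k=1}^m P(s_k(t))\,dt$, where $n(t)$ is the number of released, unfinished jobs at time $t$ and $s_k(t)$ is the speed of server $k$ (i.e., total flow time plus energy). An online algorithm learns of job $j$ only at time $a_j$. $\mathsf{OPT}$ denotes the offline optimal schedule, which knows $\sigma$ in advance and minimizes $C$. An online algorithm $A$ is $c$-competitive if $C_A(\sigma)\le c\,C_{\mathsf{OPT}}(\sigma)$ for every input instance $\sigma$. *)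

(* Defs.v *)
From HB Require Import structures.
From mathcomp Require Import all_boot all_order all_algebra.
From mathcomp Require Import all_classical all_reals all_analysis.
Set Implicit Arguments. Unset Strict Implicit. Unset Printing Implicit Defensive.
Import Order.TTheory GRing.Theory Num.Theory.
Import numFieldNormedType.Exports.
Local Open Scope classical_set_scope.
Local Open Scope ring_scope.

Section SpeedScaling.
Context {R : realType}.

(* A schedule for [m] servers and [N] jobs (indexed by 'I_N):
   [s k t]   = speed of server k at time t,
   [asg k t] = job processed by server k at time t (None = no job).
   Migration is allowed (the assignment may change arbitrarily over time). *)

Definition job_rate (m N : nat) (s : 'I_m -> R -> R)
  (asg : 'I_m -> R -> option 'I_N) (j : 'I_N) (u : R) : R :=
  \sum_(k < m | asg k u == Some j) s k u.

Definition work_done (m N : nat) (s : 'I_m -> R -> R)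
  (asg : 'I_m -> R -> option 'I_N) (j : 'I_N) (t : R) : \bar R :=
  (\int[@lebesgue_measure R]_(u in `]-oo, t]) (job_rate s asg j u)%:E)%E.

Definition unfinished (m N : nat) (a w : 'I_N -> R) (s : 'I_m -> R -> R)
  (asg : 'I_m -> R -> option 'I_N) (j : 'I_N) (t : R) : bool :=
  (a j <= t) && (work_done s asg j t < (w j)%:E)%E.

Definition nunf (m N : nat) (a w : 'I_N -> R) (s : 'I_m -> R -> R)
  (asg : 'I_m -> R -> option 'I_N) (t : R) : nat :=
  #|[set j : 'I_N | unfinished a w s asg j t]|.

Definition feasible (m N : nat) (a : 'I_N -> R) (s : 'I_m -> R -> R)
  (asg : 'I_m -> R -> option 'I_N) : Prop :=
  [/\ (forall k t, 0 <= s k t),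
      (forall k, measurable_fun setT (s k)),
      (forall k j, measurable [set t : R | asg k t = Some j]),
      (forall k k' t j, asg k t = Some j -> asg k' t = Some j -> k = k') &
      (forall k t j, asg k t = Some j -> a j <= t)].

(* cost = total flow time + energy *)
Definition cost (m N : nat) (P : R -> R) (a w : 'I_N -> R)
  (s : 'I_m -> R -> R) (asg : 'I_m -> R -> option 'I_N) : \bar R :=
  (\int[@lebesgue_measure R]_(t in [set: R]) ((nunf a w s asg t)%:R)%:E
   + \int[@lebesgue_measure R]_(t in [set: R]) (\sum_(k < m) P (s k t))%:E)%E.

(* The online algorithm: at every time t, the min(m, n(t)) unfinished jobs with
   shortest remaining sizes are served on distinct servers (SRPT with
   migration; ties broken arbitrarily); each busy server runs at speed
   P^{-1}(n(t)/m) if n(t) >= m and P^{-1}(1) otherwise (expressed as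
   P(speed) = ..., speed >= 0, which determines the speed uniquely since P is
   strictly increasing on R_+); idle servers run at speed 0. *)
Definition srpt_alg (m N : nat) (P : R -> R) (a w : 'I_N -> R)
  (s : 'I_m -> R -> R) (asg : 'I_m -> R -> option 'I_N) : Prop :=
  feasible a s asg /\
  forall t : R,
    let n := nunf a w s asg t in
    let served := fun j : 'I_N => [exists k, asg k t == Some j] in
    [/\ (forall j, served j -> unfinished a w s asg j t),
        #|[set j : 'I_N | served j]| = minn m n,
        (forall j j', served j -> unfinished a w s asg j' t -> ~~ served j' ->
           ((w j)%:E - work_done s asg j t <= (w j')%:E - work_done s asg j' t)%E),
        (forall k, asg k t = None -> s k t = 0) &
        (forall k j, asg k t = Some j ->
           P (s k t) = if (m <= n)%N then n%:R / m%:R else 1)].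

Definition sbar (P : R -> R) : R := inf [set x : R | 0 < x /\ x < P x].

End SpeedScaling.

(* Main.v *)
Require Import Defs.
From HB Require Import structures.
From mathcomp Require Import all_boot all_order all_algebra.
From mathcomp Require Import ring lra zify.
Set Implicit Arguments. Unset Strict Implicit. Unset Printing Implicit Defensive.
Import Order.TTheory GRing.Theory Num.Theory.
Local Open Scope ring_scope.

(** The energy spent by the algorithm at time [t] is exactly [n t], so its cost
    is twice its flow time, and it suffices to bound the flow time.  This is
    done with a potential that compares the algorithm with an arbitrary
    schedule, which need not follow SRPT.  Write [Z k] for the sum of all but
    the [k] largest remaining sizes, and let
      [Phi i = max (0, max_k (Z (i + k) of the algorithm - Z k of the other))].
    Releasing jobs does not increase [Phi i].  Let [Y] be the total speed of
    the other schedule, [V] the common speed of the busy servers of the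
    algorithm and [G = n - n_o].  Between releases [Phi i] grows at rate at most
    [Y - V * min (m, G - i)] if [i < G], at most [max (0, Y - V)] if
    [G <= i < n], and it stays zero if [i >= n].  The potential is a weighted sum
    of the [Phi i], plus [1 / s1] times the difference of the total remaining
    sizes.  The weights are the increments [D (i + 1) - D i] of a slope
    function: for [m = 1], [D] is the chord slope of [P] between the levels
    [i - 1] and [i]; for [m >= 2], [D i = C * x / P^-1 x] with [x = i / m], and
    the loss caused by spreading the work over [m] jobs is absorbed by
    submultiplicativity, applied to the factor [2 - 1/m].  In both cases [n]
    plus the drift of the potential is at most [P (2 - 1/m) * (1 + 1 / s1)]
    times the sum of [n_o] and the power used by the other schedule. *)

(** * Sums of all but the largest remaining sizes *)

Section DropSum.
Context {R : realFieldType} {I : finType}.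
Implicit Types (p q w d : I -> R) (K M S U : {set I}) (k i : nat).

(** Minimizing over sets of at most [k] elements needs no sorting: every such set yields an upper
    bound, and the minimum is attained. *)
Definition drop_arg k p : {set I} :=
  [arg min_(K < set0 | (#|K| <= k)%N) (\sum_(x | x \notin K) p x)]%O.

(* The sum of all but the [k] largest values of [p]. *)
Definition drop_sum k p : R := \sum_(x | x \notin drop_arg k p) p x.

Lemma drop_sum_le k p K : (#|K| <= k)%N -> drop_sum k p <= \sum_(x | x \notin K) p x.
Proof.
rewrite /drop_sum /drop_arg; case: Order.TotalTheory.arg_minP => [|K0 _ H]; first by rewrite cards0.
exact: H.
Qed.

Lemma drop_sumP k p : exists2 K : {set I}, (#|K| <= k)%N & drop_sum k p = \sum_(x | x \notin K) p x.
Proof.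
exists (drop_arg k p) => //; rewrite /drop_arg.
by case: Order.TotalTheory.arg_minP => //; rewrite cards0.
Qed.

Lemma drop_sum_ge0 k p : (forall x, 0 <= p x) -> 0 <= drop_sum k p.
Proof. by move=> p0; apply: sumr_ge0. Qed.

Lemma drop_sum_anti k l p : (k <= l)%N -> drop_sum l p <= drop_sum k p.
Proof.
by move=> kl; have [K Kk ->] := drop_sumP k p; apply: drop_sum_le; exact: leq_trans kl.
Qed.

Lemma drop_sum_leD k p q d : (forall x, 0 <= d x) -> (forall x, p x <= q x + d x) ->
  drop_sum k p <= drop_sum k q + \sum_x d x.
Proof.
move=> d0 pq; have [K Kk ->] := drop_sumP k q.
rewrite (le_trans (drop_sum_le _ Kk))//.
rewrite (le_trans (ler_sum _ (fun x _ => pq x)))// big_split/= lerD2l.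
by rewrite [leRHS](bigID (fun x => x \notin K))/= lerDl sumr_ge0.
Qed.

Lemma drop_sum_eq0 k p : (forall x, 0 <= p x) -> (#|[set x | p x != 0%R]| <= k)%N ->
  drop_sum k p = 0.
Proof.
move=> p0 pk; apply/eqP; rewrite eq_le drop_sum_ge0// andbT.
rewrite (le_trans (drop_sum_le p pk))// big1// => x.
by rewrite inE negbK => /eqP.
Qed.

(* A minimizer meeting [S] as little as possible; an exchange argument shows
   that it contains all of [U :\: S] unless it avoids [S]. *)
Lemma drop_sum_served k p U S : (forall x, x \notin U -> p x = 0) -> S \subset U ->
  (forall x y, x \in S -> y \in U -> y \notin S -> p x <= p y) ->
  exists K : {set I}, [/\ (#|K| <= k)%N, \sum_(x | x \notin K) p x = drop_sum k p &
    (minn #|S| (#|U| - k) <= #|S :\: K|)%N].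
Proof.
move=> pU SU Smin.
pose opt K := (#|K| <= k)%N && (\sum_(x | x \notin K) p x == drop_sum k p).
have [K0 K0k K0e] := drop_sumP k p.
have oK0 : opt K0 by rewrite /opt K0k K0e eqxx.
pose K := [arg min_(K < K0 | opt K) #|S :&: K|].
have [Kopt Kmin] : opt K /\ forall K', opt K' -> (#|S :&: K| <= #|S :&: K'|)%N.
  by rewrite /K; case: arg_minnP.
have /andP[Kk /eqP Ke] := Kopt.
exists K; split=> //.
have [SK0|/set0Pn[x]] := eqVneq (S :&: K) set0.
  by rewrite -(cardsID K S) SK0 cards0 add0n geq_minl.
rewrite inE => /andP[xS xK].
(* Then every element of [U] outside [K] lies in [S], so [S :\: K] has at least [#|U| - k]
   elements. *)
suff USK : U :\: S \subset K.
  rewrite (leq_trans (geq_minr _ _))// leq_subLR.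
  rewrite (leq_trans _ (leq_add Kk (leqnn _)))// -cardsUI -(cardsID S U).
  rewrite (leq_trans _ (leq_addr _ _))// addnC -cardsUI.
  rewrite (_ : _ :&: (U :&: S) = set0) ?cards0 ?addn0; last first.
    by apply/setP => z; rewrite !inE; case: (z \in S); rewrite ?andbF.
  apply/subset_leq_card/subsetP => z; rewrite !inE.
  case zS : (z \in S); case zK : (z \in K) => //=; rewrite andbF ?orbF// => zU.
  by rewrite -zK (subsetP USK)// !inE zS.
(* If [y] were missing from [K], trading [x] for [y] would not increase the sum, since [p x <= p y],
   and would meet [S] in fewer elements. *)
apply/subsetP => y; rewrite inE => /andP[yS yU]; apply: contraT => yK.
have xy : x != y by apply: contraNneq yS => <-.
pose K' := y |: (K :\ x).
have K'k : (#|K'| <= k)%N.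
  by apply: leq_trans Kk; rewrite /K' cardsU1 [leqRHS](cardsD1 x K) xK !inE (negbTE yK) andbF.
have sumE : \sum_(z | z \notin K') p z + p y = \sum_(z | z \notin K) p z + p x.
  have K'x : x \notin K' by rewrite !inE eqxx/= orbF.
  rewrite (bigD1 x)//= [X in _ = X + _](bigD1 y)//=.
  have -> : \sum_(z | (z \notin K') && (z != x)) p z = \sum_(z | (z \notin K) && (z != y)) p z.
    apply: eq_bigl => z; rewrite !inE; have [->|zx] := eqVneq z x.
      by rewrite xK andbF.
    by rewrite andbT negb_or andbC.
  by ring.
have oK' : opt K'.
  rewrite /opt K'k eq_le drop_sum_le// andbT -Ke.
  by have := Smin _ _ xS yU yS; move: sumE; lra.
have := Kmin _ oK'; rewrite leqNgt => /negP; case.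
rewrite [ltnRHS](cardsD1 x) inE xS xK/= ltnS subset_leq_card//.
apply/subsetP => z; rewrite !inE => /andP[zS /orP[/eqP zy|/andP[-> ->]]].
  by rewrite -zy zS in yS.
by rewrite zS.
Qed.

(* [M] is the set of newly released jobs: they have the same sizes [w] in both
   configurations, and were counted as [0] before. *)
Lemma drop_sum_release i k p q p' q' w M : (forall x, 0 <= w x) ->
  (forall x, x \in M -> q x = 0) ->
  (forall x, 0 <= p x) -> (forall x, 0 <= q x) ->
  (forall x, p' x <= p x + (if x \in M then w x else 0)) ->
  (forall x, q' x = q x + (if x \in M then w x else 0)) ->
  exists2 l, (l <= k)%N &
    drop_sum (i + k) p' - drop_sum k q' <= drop_sum (i + l) p - drop_sum l q.
Proof.
move=> w0 qM p0 q0 pp' qq'.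
have [K Kk Ke] := drop_sumP k q'.
pose W := \sum_(x | x \notin K) (if x \in M then w x else 0).
(* The new jobs dropped from [q'] are dropped from [p'] as well, which leaves [l] places for old
   jobs. Then the sum for [q'] gains at least [W] and that for [p'] at most [W]. *)
pose l := (k - #|K :&: M|)%N.
have KMk : (#|K :&: M| <= k)%N by rewrite (leq_trans _ Kk)// subset_leq_card// subsetIl.
exists l; first exact: leq_subr.
have Hq : drop_sum l q + W <= drop_sum k q'.
  rewrite Ke (eq_bigr _ (fun x _ => qq' x)) big_split/= lerD2r.
  rewrite (le_trans (drop_sum_le (K := K :\: M) _ _))//.
    by rewrite /l leq_subRL// cardsID.
  rewrite [leLHS](bigID (fun x => x \notin K))/= [X in _ + X]big1 ?addr0.
    rewrite le_eqVlt; apply/orP; left; apply/eqP/eq_bigl => x.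
    by rewrite !inE; case: (x \in K); rewrite ?andbF.
  by move=> x /andP[]; rewrite !inE negb_and !negbK => /orP[xM|/negbTE->//] _; rewrite qM.
have [K' K'l K'e] := drop_sumP (i + l) p.
have Hp : drop_sum (i + k) p' <= drop_sum (i + l) p + W.
  rewrite (le_trans (drop_sum_le (K := K' :|: (K :&: M)) _ _))//.
    rewrite (leq_trans (leq_card_setU _ _))//.
    by rewrite (leq_trans (leq_add K'l (leqnn _)))// -addnA /l subnK.
  rewrite (le_trans (ler_sum _ (fun x _ => pp' x)))// big_split/= lerD//.
    rewrite K'e [leRHS](bigID (fun x => x \notin K' :|: (K :&: M)))/=.
    rewrite (eq_bigl (fun x => (x \notin K') && (x \notin K' :|: K :&: M))) ?lerDl ?sumr_ge0//.
    by move=> x; rewrite !inE; case: (x \in K').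
  rewrite /W [leLHS](bigID (fun x => x \notin K))/= [X in _ + X]big1 ?addr0; last first.
    move=> x; rewrite !inE negbK => /andP[+ xK]; rewrite xK/= negb_or => /andP[_].
    by move/negbTE->.
  rewrite [leRHS](bigID (fun x => x \notin K' :|: (K :&: M)))/=.
  rewrite (eq_bigl (fun x => (x \notin K) && (x \notin K' :|: K :&: M))); last first.
    by move=> x; rewrite andbC.
  by rewrite lerDl sumr_ge0// => x _; case: ifP.
lra.
Qed.

(* For remaining sizes [p] and [q] and [n p x], [n q x] the numbers of jobs of
   remaining size at least [x], this is at most the integral over [x] of the
   positive part of [n p x - n q x - i].  Unlike that integral, its growth is
   controlled by the total speed spent on [q] alone, whichever jobs are served. *)
Definition excess i p q : R :=
  \big[Num.max/0]_(k < #|I|.+1) (drop_sum (i + k) p - drop_sum k q).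

Lemma excess_ge0 i p q : 0 <= excess i p q.
Proof. exact: bigmax_ge_id. Qed.

Lemma le_excess i p q k : (k <= #|I|)%N ->
  drop_sum (i + k) p - drop_sum k q <= excess i p q.
Proof.
move=> kI; have kI' : (k < #|I|.+1)%N by [].
exact: (le_bigmax_cond 0 (fun k : 'I__ => drop_sum (i + k) p - drop_sum k q)
  (j := Ordinal kI')).
Qed.

Lemma excess_le i p q c : 0 <= c ->
  (forall k, (k <= #|I|)%N -> drop_sum (i + k) p - drop_sum k q <= c) ->
  excess i p q <= c.
Proof. by move=> c0 H; apply: bigmax_le => // k _; apply: H; rewrite -ltnS. Qed.

Definition excess_rate (m n no : nat) (Y V : R) i : R :=
  if (i + no < n)%N then Y - V * (minn m (n - no - i))%:R
  else if (i < n)%N then Num.max 0 (Y - V) else 0.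

(** A time step of length [h] with error [e]. By [drop_sum_served], a suitable minimizer for
    [drop_sum (i + k) p] counts at least [minn (minn m #|U|) (#|U| - (i + k))] served jobs, each
    losing [V * h], while [drop_sum k q] loses at most [Y * h], up to errors. *)
Lemma excess_step i m p q p' q' d S (Y V e h : R) :
  let U := [set x | p x != 0] in let no := #|[set x | q x != 0%R]| in
  (0 < m)%N -> 0 <= Y -> 0 <= V -> 0 < e -> 0 < h ->
  (forall x, 0 <= p' x) -> (forall x, p' x <= p x) ->
  (forall x, 0 <= q' x) -> (forall x, q x = 0 -> q' x = 0) ->
  (forall x, 0 <= d x) -> (forall x, q x <= q' x + d x) ->
  \sum_x d x <= (Y + e) * h ->
  S \subset U -> #|S| = minn m #|U| ->
  (forall x y, x \in S -> y \in U -> y \notin S -> p x <= p y) ->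
  (forall x, x \in S -> p' x <= p x - (V - e) * h) ->
  excess i p' q' <= excess i p q +
    (excess_rate m #|U| no Y V i + (#|I|.+1)%:R * e) * h.
Proof.
move=> U no m0 Y0 V0 e0 h0 p'0 p'p q'0 qq' d0 qd dY SU cS Smin Srate.
have noI : (no <= #|I|)%N by rewrite max_card.
have q'no k : (no <= k)%N -> drop_sum k q' = 0.
  move=> nok; apply: drop_sum_eq0 => //; apply: leq_trans nok.
  apply/subset_leq_card/subsetP => x; rewrite !inE; apply: contra_neq; exact: qq'.
have p'n k : (#|U| <= k)%N -> drop_sum k p' = 0.
  move=> Uk; apply: drop_sum_eq0 => //; apply: leq_trans Uk.
  apply/subset_leq_card/subsetP => x; rewrite !inE; apply: contra_neq => px0.
  by apply/eqP; rewrite eq_le p'0 andbT -px0.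
have pk k : drop_sum k p' <= drop_sum k p -
    (V * (minn (minn m #|U|) (#|U| - k))%:R - #|I|%:R * e) * h.
  have [|K [Kk Ke SK]] := drop_sum_served k _ SU Smin.
    by move=> x; rewrite inE negbK => /eqP.
  rewrite cS in SK.
  have : \sum_(x | x \notin K) p' x <= \sum_(x | x \notin K) p x - #|S :\: K|%:R * ((V - e) * h).
    have sw (f : I -> R) : \sum_(x | x \notin K) f x =
        \sum_(x in S :\: K) f x + \sum_(x | (x \notin K) && (x \notin S)) f x.
      by rewrite (bigID (mem S))/=; congr (_ + _); apply: eq_bigl => x; rewrite inE.
    rewrite !sw addrAC lerD// ?ler_sum//.
    rewrite mulr_natl -sumr_const -sumrB; apply: ler_sum => x.
    by rewrite inE => /andP[_ xS]; exact: Srate.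
  rewrite Ke => H; rewrite (le_trans (drop_sum_le _ Kk))// (le_trans H)//.
  rewrite lerD2l lerN2 mulrA ler_pM2r// mulrBr.
  have H1 : V * (minn (minn m #|U|) (#|U| - k))%:R <= #|S :\: K|%:R * V.
    by rewrite mulrC ler_wpM2r// ler_nat.
  have H2 : #|S :\: K|%:R * e <= #|I|%:R * e by rewrite ler_pM2r// ler_nat max_card.
  lra.
have qk k : drop_sum k q <= drop_sum k q' + (Y + e) * h.
  by rewrite (le_trans (drop_sum_leD k d0 qd))// lerD2l.
have E : (#|I|.+1)%:R * e = #|I|%:R * e + e by rewrite -addn1 natrD mulrDl mul1r.
have uk k : (k <= #|I|)%N -> drop_sum (i + k) p' - drop_sum k q' <= excess i p q +
    (Y - V * (minn (minn m #|U|) (#|U| - (i + k)))%:R + (#|I|.+1)%:R * e) * h.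
  by move=> kI; have := pk (i + k)%N; have := qk k; have := le_excess i p q kI; rewrite E; lra.
have Ie0 : 0 <= (#|I|.+1)%:R * e * h by rewrite !mulr_ge0// ltW.
have ex0 := excess_ge0 i p q.
rewrite /excess_rate; case: ifPn => [ino|].
  have good k : (k <= no)%N -> drop_sum (i + k) p' - drop_sum k q' <= excess i p q +
      (Y - V * (minn m (#|U| - no - i))%:R + (#|I|.+1)%:R * e) * h.
    move=> kno; rewrite (le_trans (uk _ _))//; first exact: leq_trans noI.
    rewrite lerD2l ler_pM2r// lerD2r lerD2l lerN2 ler_wpM2l// ler_nat.
    by lia.
  apply: excess_le.
    by apply: le_trans (good _ (leqnn _)); rewrite (q'no no)// subr0 drop_sum_ge0.
  move=> k kI; have [|nok] := leqP k no; first exact: good.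
  (* Beyond [k = no] the sum of [q'] vanishes and that of [p'] only decreases, so the bound at
     [k = no] suffices. *)
  apply: le_trans (good _ (leqnn _)); rewrite !q'no// ?subr0; last exact: ltnW.
  by apply: drop_sum_anti; rewrite leq_add2l ltnW.
rewrite -leqNgt => ino; case: ifPn => [iU|].
  have YV : 0 <= Num.max 0 (Y - V) * h by rewrite mulr_ge0 ?le_max ?lexx// ltW.
  apply: excess_le; first by rewrite mulrDl !addr_ge0.
  move=> k kI; have [ik|ik] := ltnP (i + k) #|U|; last first.
    by rewrite p'n// sub0r (le_trans (_ : _ <= 0)) ?oppr_le0 ?drop_sum_ge0// mulrDl !addr_ge0.
  rewrite (le_trans (uk _ kI))// lerD2l ler_pM2r// lerD2r le_max; apply/orP; right.
  (* As [i + k < #|U|], at least one served job is counted: this is the single [V] of the middle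
     range. *)
  rewrite lerD2l lerN2 ler_peMr// ler1n; lia.
rewrite -leqNgt => Ui; apply: excess_le; first by rewrite add0r addr_ge0.
move=> k kI; rewrite p'n; last by rewrite (leq_trans Ui) ?leq_addr.
by rewrite sub0r (le_trans (_ : _ <= 0)) ?oppr_le0 ?drop_sum_ge0// add0r addr_ge0.
Qed.

End DropSum.

(** * Pointwise drift inequalities *)

Section ExcessDrift.
Context {R : realFieldType}.
Variables (D : nat -> R).
Hypotheses (D0 : D 0 = 0) (Dhomo : {homo D : i j / (i <= j)%N >-> i <= j}).

Let telescope_lt (N n : nat) : (n <= N)%N ->
  \sum_(i < N) (D i.+1 - D i) * (i < n)%N%:R = D n.
Proof.
move=> nN; rewrite (eq_bigr (fun i : 'I_N => if (i < n)%N then D i.+1 - D i else 0)); last first.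
  by move=> i _; case: ifP; rewrite ?mulr1 ?mulr0.
rewrite -big_mkcond/= -(big_ord_widen N (fun i => D i.+1 - D i) nN).
by rewrite -(big_mkord xpredT (fun i => D i.+1 - D i)) telescope_sumr// D0 subr0.
Qed.

Let step_ge0 i : 0 <= D i.+1 - D i.
Proof. by rewrite subr_ge0 Dhomo. Qed.

(** Summation by parts: [minn m (n - no - i)] counts the [k < m] with [i < n - no - k], so the
    weights telescope to values of [D]. In the middle range [max (0, Y - V)] is bounded by [Y]. *)
Lemma sum_excess_rate_le (N m n no : nat) (Y V : R) : (n <= N)%N -> 0 <= Y -> 0 <= V ->
  \sum_(i < N) (D i.+1 - D i) * excess_rate m n no Y V i <=
  Y * D n - V * \sum_(k < m) D (n - no - k)%N.
Proof.
move=> nN Y0 V0.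
have H (i : nat) : excess_rate m n no Y V i <=
    Y * (i < n)%N%:R - V * \sum_(k < m) (i < n - no - k)%N%:R.
  have -> : \sum_(k < m) (i < n - no - k)%N%:R = (minn m (n - no - i))%:R :> R.
    rewrite -natr_sum; congr (_%:R); rewrite -(big_mkord xpredT (fun k => (i < n - no - k)%N : nat)).
    elim: m => [|m IH]; first by rewrite big_geq// min0n.
    rewrite big_nat_recr//= IH; lia.
  rewrite /excess_rate; case: ifPn => [ino|ino].
    by rewrite (_ : (i < n)%N) ?mulr1//; lia.
  rewrite (_ : (n - no - i)%N = 0%N) ?minn0 ?mulr0 ?subr0; last by lia.
  case: ifP => _; last by rewrite mulr0.
  by rewrite mulr1 ge_max Y0 lerBlDr lerDl.
apply: (le_trans (ler_sum _ (fun (i : 'I_N) _ => ler_wpM2l (step_ge0 i) (H i)))).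
rewrite -(telescope_lt nN) mulr_sumr.
rewrite (eq_bigr (fun k : 'I_m => \sum_(i < N) (D i.+1 - D i) * (i < n - no - k)%N%:R)); last first.
  by move=> k _; rewrite telescope_lt//; lia.
rewrite exchange_big/= mulr_sumr -sumrB; apply: ler_sum => i _.
by rewrite -mulr_sumr; lra.
Qed.

(** With one server the rate is [Y - V] on all levels below [n] when [V <= Y]; otherwise only the
    levels below [n - no] contribute, as the middle range stays at zero. Keeping the sign of [Y - V]
    makes this sharper than the general bound. *)
Lemma sum_excess_rate1_le (N n no : nat) (Y V : R) : (n <= N)%N ->
  \sum_(i < N) (D i.+1 - D i) * excess_rate 1 n no Y V i <=
  (if V <= Y then D n else D (n - no)%N) * (Y - V).
Proof.
move=> nN.
have nnoN : (n - no <= N)%N by rewrite (leq_trans _ nN)// leq_subr.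
rewrite (_ : _ * (Y - V) = \sum_(i < N) (D i.+1 - D i) *
   ((i < if (V <= Y)%R then n else n - no)%N%:R * (Y - V))); last first.
  under eq_bigr do rewrite mulrA; rewrite -mulr_suml.
  by case: ifP => _; rewrite telescope_lt.
apply: ler_sum => i _; apply: ler_wpM2l => //; rewrite /excess_rate.
case: ifPn => [ino|ino].
  rewrite (_ : minn _ _ = 1)%N ?mulr1; last by lia.
  by case: ifP => _; rewrite (_ : (_ < _)%N) ?mul1r//; lia.
case: (leP V Y) => VY; last first.
  rewrite (_ : (i < n - no)%N = false) ?mul0r; last by lia.
  by case: ifP => // _; rewrite ge_max lexx/= subr_le0 ltW.
case: ifP => _; last by rewrite mul0r.
by rewrite mul1r ge_max subr_ge0 VY lexx.
Qed.

End ExcessDrift.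

Lemma leq_subK i j : (i <= i - j + j)%N.
Proof. by rewrite addnC -leq_subLR. Qed.

(** * Power functions: convexity and submultiplicativity *)

Section PowerFunction.
Context {R : realFieldType}.
Variables (P : R -> R) (s1 : R).
Hypotheses (P0 : P 0 = 0).
Hypothesis P_incr : forall x y, 0 <= x -> x < y -> P x < P y.
Hypothesis P_sconv : forall x y l, 0 <= x -> 0 <= y -> x != y -> 0 < l -> l < 1 ->
      P (l * x + (1 - l) * y) < l * P x + (1 - l) * P y.
Hypothesis P_submult : forall x y, 0 < x -> 0 < y -> P (x * y) <= P x * P y.
Hypotheses (Hs1 : 0 <= s1) (Ps1 : P s1 = 1).

Lemma power_gt0 x : 0 < x -> 0 < P x.
Proof. by move=> x0; rewrite -P0; apply: P_incr. Qed.

Lemma power_ge0 x : 0 <= x -> 0 <= P x.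
Proof. by rewrite le_eqVlt => /predU1P[<-|/power_gt0/ltW//]; rewrite P0. Qed.

Lemma power_le x y : 0 <= x -> x <= y -> P x <= P y.
Proof. by move=> x0; rewrite le_eqVlt => /predU1P[->//|/(P_incr x0)/ltW]. Qed.

Lemma power_le_inv x y : 0 <= y -> P x <= P y -> x <= y.
Proof. by move=> y0; apply: contraTle => /(P_incr y0); rewrite ltNge. Qed.

Lemma power_inj x y : 0 <= x -> 0 <= y -> P x = P y -> x = y.
Proof. by move=> x0 y0 xy; apply/eqP; rewrite eq_le; apply/andP; split; apply: power_le_inv; rewrite // xy. Qed.

(** Convexity between [0] and [y] with [P 0 = 0] makes [P x / x] nondecreasing; the product form
    includes [x = 0]. *)
Lemma power_star x y : 0 <= x -> x <= y -> P x * y <= x * P y.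
Proof.
move=> x0; rewrite le_eqVlt => /predU1P[->|xy]; first by rewrite mulrC.
move: x0; rewrite le_eqVlt => /predU1P[<-|x0]; first by rewrite P0 !mul0r.
have y0 := lt_trans x0 xy.
have l0 : 0 < x / y by rewrite divr_gt0.
have l1 : x / y < 1 by rewrite ltr_pdivrMr// mul1r.
have := P_sconv (ltW y0) (lexx 0) (lt0r_neq0 y0) l0 l1.
rewrite P0 !mulr0 !addr0 divfK ?gt_eqF// => /ltW.
by rewrite -(ler_pM2r y0) mulrAC divfK ?gt_eqF.
Qed.

Lemma power_s1_gt0 : 0 < s1.
Proof.
rewrite lt_neqAle Hs1 andbT; apply/eqP => s10.
by have := @oner_neq0 R; rewrite -Ps1 -s10 P0 eqxx.
Qed.

Lemma power1_ge1 : 1 <= P 1.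
Proof.
have := P_submult (@ltr01 R) ltr01; rewrite mulr1.
by rewrite -{1}[P 1]mulr1 ler_pM2l// power_gt0.
Qed.

Lemma power_s1_le1 : s1 <= 1.
Proof. by apply: power_le_inv => //; rewrite Ps1 power1_ge1. Qed.

Lemma power_ge_id x : 1 <= x -> x <= P x.
Proof.
move=> x1; have := power_star ler01 x1; rewrite mul1r.
apply: le_trans; rewrite -{1}[x]mul1r ler_pM2r ?power1_ge1//.
exact: lt_le_trans x1.
Qed.

(** Below [s1] the indicator of a busy server pays for its speed; above it [P x / x] is at least
    [1 / s1]. Summed over servers, the indicators are charged to distinct unfinished jobs. *)
Lemma speed_le x : 0 <= x -> x <= s1 * ((x != 0)%:R + P x).
Proof.
move=> x0; have s10 := power_s1_gt0.
have [->|xn0] := eqVneq x 0; first by rewrite P0 addr0 mulr0.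
have [xs|/ltW sx] := leP x s1.
  by rewrite (le_trans xs)// ler_peMr ?(ltW s10)// lerDl power_ge0.
have := power_star Hs1 sx; rewrite Ps1 mul1r => /le_trans; apply.
by rewrite ler_wpM2l// lerDr.
Qed.

(** * Drift for one server, with [Q i] the speed of power [i / m] *)

Variables (m : nat) (Q : nat -> R).
Hypotheses (Q_ge0 : forall i, 0 <= Q i) (PQ : forall i, P (Q i) = i%:R / m%:R).

Let Q_le i j : (0 < m)%N -> (i <= j)%N -> Q i <= Q j.
Proof.
by move=> m0 ij; apply: power_le_inv => //; rewrite !PQ ler_pM2r ?invr_gt0 ?ltr0n// ler_nat.
Qed.

Let Q0 : Q 0 = 0.
Proof.
by apply/eqP; rewrite eq_le Q_ge0 andbT; apply: power_le_inv => //; rewrite PQ mul0r P0.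
Qed.

Let Q_lt i : (0 < m)%N -> Q i < Q i.+1.
Proof.
move=> m0; rewrite ltNge; apply/negP => /(power_le (Q_ge0 _)).
by rewrite !PQ ler_pM2r ?invr_gt0 ?ltr0n// ler_nat ltnn.
Qed.

Let Q_gt0 i : (0 < m)%N -> (0 < i)%N -> 0 < Q i.
Proof. by move=> m0; case: i => // i _; apply: le_lt_trans (Q_lt i m0). Qed.

(** For [m = 1] this is the slope of [P] between the levels [j] and [j + 1], where [P] rises by
    exactly one. The value [0] at [0] starts the telescoping. *)
Definition chord_slope i : R := if i is j.+1 then (Q i - Q j)^-1 else 0.

Lemma chord_slope_homo : m = 1%N -> {homo chord_slope : i j / (i <= j)%N >-> i <= j}.
Proof.
move=> m1; apply: homo_leq => [//|x y z /le_trans|]; first exact.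
have m0 : (0 < m)%N by rewrite m1.
move=> [|i]; first by rewrite /= invr_ge0 subr_ge0 ltW// Q_lt.
rewrite /= lef_pV2 ?posrE ?subr_gt0 ?Q_lt//.
have ab := Q_lt i m0; have bc := Q_lt i.+1 m0.
set a := Q i in ab *; set b := Q i.+1 in ab bc *; set c := Q i.+2 in bc *.
rewrite leNgt; apply/negP => H.
have ac : a != c by rewrite lt_eqF// (lt_trans ab).
(* If the chord slopes decreased, [b] would lie below the midpoint of [a] and [c]; but [P b] is the
   mean of [P a] and [P c], against monotonicity and strict convexity. *)
have h0 : 0 < (1 / 2 : R) by lra.
have h1 : (1 / 2 : R) < 1 by lra.
have := P_sconv (Q_ge0 i) (Q_ge0 i.+2) ac h0 h1.
have /(P_incr (Q_ge0 i.+1)) : b < 1 / 2 * a + (1 - 1 / 2) * c by lra.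
rewrite /a /b /c !PQ m1 !divr1 -[i.+2%:R]natr1 -[i.+1%:R]natr1; lra.
Qed.

Lemma power_3pt x y z : 0 <= x -> x < y -> y < z ->
  (P y - P x) * (z - y) <= (P z - P y) * (y - x).
Proof.
move=> x0 xy yz; have xz := lt_trans xy yz.
have d0 : 0 < z - x by rewrite subr_gt0.
have l0 : 0 < (z - y) / (z - x) by rewrite divr_gt0 ?subr_gt0.
have l1 : (z - y) / (z - x) < 1 by rewrite ltr_pdivrMr// mul1r; lra.
have := P_sconv x0 (le_trans x0 (ltW xz)) (negbT (lt_eqF xz)) l0 l1.
rewrite (_ : _ + _ * z = y); last by field; rewrite gt_eqF.
move/ltW; rewrite -(ler_pM2r d0).
rewrite (_ : (_ + _) * _ = (z - y) * P x + (y - x) * P z); last by field; rewrite gt_eqF.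
lra.
Qed.

(** A convex function lies above the extensions of its chords. For [y] above [V = Q n] the chord
    ending at level [n] is used, for smaller [y] the chord ending at level [n - no]. The subtracted
    [minn m n] is recovered later from the total remaining sizes. *)
Lemma drift_single (N n no : nat) (y V : R) : m = 1%N -> (n <= N)%N -> 0 <= y ->
  (n != 0%N -> P V = n%:R / m%:R) -> 0 <= V ->
  \sum_(i < N) (chord_slope i.+1 - chord_slope i) * excess_rate m n no y V i
    + n%:R - (minn m n)%:R <= no%:R + P y.
Proof.
clear Hs1 Ps1; move=> m1 nN y0 PV V0.
have m0 : (0 < m)%N by rewrite m1.
have := sum_excess_rate1_le (erefl : chord_slope 0 = 0) (chord_slope_homo m1) no y V nN.
rewrite -{1}m1; move: PV; case: n nN => [|n] nN PV.
  by rewrite sub0n if_same mul0r minn0 subr0 addr0 => /le_trans; apply; rewrite addr_ge0 ?power_ge0.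
have VQ : V = Q n.+1.
  by apply: power_inj => //; rewrite PQ PV.
rewrite (_ : minn _ _ = 1)%N; last by lia.
move=> H; rewrite -lerBrDr -lerBrDr (le_trans H)// {H}VQ -natr1.
have Q1 := Q_lt n m0; have PQn := PQ n.+1; rewrite m1 divr1 -natr1 in PQn.
have PQ' := PQ n; rewrite m1 divr1 in PQ'.
case: (leP (Q n.+1) y) => yQ.
  move: yQ; rewrite le_eqVlt => /predU1P[<-|yQ].
    by rewrite subrr mulr0 PQn; have := ler0n R no; lra.
  have := power_3pt (Q_ge0 n) Q1 yQ; rewrite PQn PQ' => H.
  have : (Q n.+1 - Q n)^-1 * (y - Q n.+1) <= P y - (n%:R + 1).
    rewrite ler_pdivrMl ?subr_gt0// mulrC; lra.
  by have := ler0n R no => /=; lra.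
case G : (n.+1 - no)%N => [|G'].
  rewrite mul0r; have : n.+1%:R <= no%:R :> R by rewrite ler_nat; lia.
  by rewrite -natr1; have := power_ge0 y0; lra.
have GE : n%:R + 1 = no%:R + G'%:R + 1 :> R.
  by rewrite -[in RHS]natrD !natr1; congr _%:R; lia.
have QG := Q_lt G' m0.
have PQG := PQ G'; rewrite m1 divr1 in PQG.
have PQG1 := PQ G'.+1; rewrite m1 divr1 -natr1 in PQG1.
have sl0 : 0 < (Q G'.+1 - Q G')^-1 by rewrite invr_gt0 subr_gt0.
case: (leP (Q G') y) => yG.
  (* Here [y] may lie within the interval of the chord, but [P y >= G'] suffices, because
     [minn m n = 1] is subtracted. *)
  have := power_le (Q_ge0 G') yG; rewrite PQG.
  have : (Q G'.+1 - Q G')^-1 * (y - Q n.+1) <= 0 by rewrite pmulr_rle0// subr_le0 ltW.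
  rewrite /=; lra.
have := power_3pt y0 yG QG; rewrite PQG1 PQG => H.
have QGn : Q G'.+1 <= Q n.+1 by apply: Q_le => //; rewrite -G leq_subr.
have : (G'%:R + 1) - P y <= (Q G'.+1 - Q G')^-1 * (Q G'.+1 - y).
  rewrite ler_pdivlMl ?subr_gt0//; lra.
have : (Q G'.+1 - Q G')^-1 * (Q G'.+1 - y) <= (Q G'.+1 - Q G')^-1 * (Q n.+1 - y).
  by rewrite ler_pM2l// lerD2r.
rewrite /=; lra.
Qed.

(** * Drift for several servers *)

Let b : R := 2 - m%:R^-1.
Let B : R := P b.

(* The second bound makes [1 + C * (t - 1)] nonpositive for [t <= 1 / b], where
   [P (t * V)] may be negligible; the first one is what the competitive ratio
   allows as the coefficient of the number of jobs of the other schedule. *)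
Definition ratio_const : R := Num.min (2 * B - 1) (b / (b - 1)).
Definition ratio_slope i : R := ratio_const * ((i%:R / m%:R) / Q i).

Hypothesis m2 : (1 < m)%N.

Let m0 : (0 < m)%N. Proof. exact: ltnW. Qed.

Let b_ge : 3 / 2 <= b.
Proof.
have : (m%:R : R)^-1 <= 2^-1 by rewrite lef_pV2 ?posrE ?ltr0n// ler_nat.
rewrite /b; lra.
Qed.

Let b_le : b <= 2.
Proof. by rewrite /b gerBl invr_ge0. Qed.

Let bB : b <= B.
Proof. by apply: power_ge_id; have := b_ge; lra. Qed.

Let C_ge2 : 2 <= ratio_const.
Proof.
have b1 := b_ge; have b2 := b_le; have b3 := bB.
rewrite le_min; apply/andP; split; first by lra.
by rewrite ler_pdivlMr; lra.
Qed.

Let C_leB : ratio_const <= 2 * B - 1.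
Proof. by rewrite ge_min lexx. Qed.

Let C_leb : ratio_const * (b - 1) <= b.
Proof.
have b1 := b_ge; rewrite -ler_pdivlMr; last by lra.
by rewrite ge_min lexx orbT.
Qed.

(** Since [P x / x] is nondecreasing, so is [P (Q i) / Q i]. *)
Lemma ratio_slope_homo : {homo ratio_slope : i j / (i <= j)%N >-> i <= j}.
Proof.
have C0 : 0 <= ratio_const by apply: le_trans C_ge2.
move=> [|i] [|j] // ij; rewrite /ratio_slope ?Q0.
  by rewrite mul0r mul0r mulr0 !mulr_ge0 ?invr_ge0.
rewrite ler_wpM2l// -!PQ ler_pdivrMr ?Q_gt0// mulrAC ler_pdivlMr ?Q_gt0//.
rewrite [leRHS]mulrC; apply: power_star => //; exact: Q_le.
Qed.

(** The share of one server of the other schedule, with speed [y], in the drift at load [x = n / m].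
    The cases follow [t = y / V]: for [t >= 1] convexity suffices; for smaller [t],
    submultiplicativity replaces [P V] by [B * P (V / b)], once or twice, until the compared speed
    is at most [y]. *)
Lemma ratio_scalar (V x y : R) : 0 < V -> P V = x -> 1 <= x -> 0 <= y ->
  ratio_const * x * (y / V) - ratio_const * x + ratio_const * (b - 1) / 2 + x - 1
    <= (2 * B - 1) * P y.
Proof.
move=> V0 PV x1 y0; set C := ratio_const.
have b1 := b_ge; have b2 := b_le; have b3 := bB; have C2 := C_ge2.
have C3 := C_leB; have C4 := C_leb; rewrite -/C in C2 C3 C4.
have x0 : 0 < x by lra.
pose t := y / V; have t0 : 0 <= t by rewrite divr_ge0// ltW.
have yt : y = t * V by rewrite /t divfK// gt_eqF.
have Py0 := power_ge0 y0.
(* The term [C * (b - 1) / 2] is at most [b / 2 <= 1], so the [- 1] absorbs it. *)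
suff : x * (1 + C * (t - 1)) <= (2 * B - 1) * P y by rewrite -/t; lra.
have [neg|/ltW pos] := leP (1 + C * (t - 1)) 0.
  rewrite (le_trans (_ : _ <= 0)) ?pmulr_rle0// mulr_ge0//; lra.
have [t1|t1] := leP 1 t.
  have xP : x * t <= P y.
    have Vy : V <= y by rewrite yt -[leLHS]mul1r ler_pM2r.
    have := power_star (ltW V0) Vy; rewrite PV yt mulrA [leRHS]mulrC ler_pM2r//.
  have h1 : x * (1 + C * (t - 1)) <= C * (x * t).
    by rewrite mulrCA ler_pM2l//; lra.
  have h2 : C * (x * t) <= C * P y by rewrite ler_wpM2l//; lra.
  have h3 : C * P y <= (2 * B - 1) * P y by rewrite ler_wpM2r.
  lra.
have Bsub z : 0 < z -> P z <= B * P (z / b).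
  move=> z0; have := @P_submult b (z / b); rewrite mulrCA mulfV ?mulr1 ?gt_eqF//; last by lra.
  by apply; [lra|rewrite divr_gt0//; lra].
have B0 : 0 < B by lra.
have b0 : 0 < b by lra.
have Vb0 : 0 < V / b by rewrite divr_gt0.
have [tb|tb] := leP 1 (b * t).
  have Vy : V / b <= y.
    by rewrite ler_pdivrMr// yt -[leLHS]mul1r mulrAC ler_pM2r// mulrC.
  have xP : b * t * x <= B * P y.
    rewrite -(ler_pM2r V0).
    have h1 : b * (x * y) <= b * (B * P (V / b) * y).
      by rewrite ler_pM2l// ler_wpM2r// -PV Bsub.
    have h2 : b * (B * P (V / b) * y) <= b * (B * (V / b * P y)).
      by rewrite ler_pM2l// -mulrA ler_pM2l// power_star// ltW.
    have h3 : b * (B * (V / b * P y)) = B * P y * V by field; rewrite gt_eqF.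
    have h4 : b * (x * y) = b * t * x * V by rewrite yt; ring.
    lra.
  have h1 : 1 + C * (t - 1) <= b * t.
    have : (C - b) * t <= C - b by rewrite ler_piMr; lra.
    lra.
  have h2 : x * (1 + C * (t - 1)) <= b * t * x by rewrite mulrC ler_pM2r.
  have h3 : B * P y <= (2 * B - 1) * P y by rewrite ler_wpM2r//; lra.
  lra.
(* For [t < 1 / b] the value [b / (b - 1)] would make [1 + C * (t - 1)] negative, so the minimum is
   [2 * B - 1]. *)
have Cb : C <> b / (b - 1).
  move=> CE; move: pos; apply/negP; rewrite -ltNge.
  have -> : 1 + C * (t - 1) = (b * t - 1) / (b - 1) by rewrite CE; field; rewrite gt_eqF//; lra.
  by rewrite pmulr_llt0 ?invr_gt0; lra.
have CE : C = 2 * B - 1.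
  by move: Cb; rewrite /C /ratio_const minElt; case: ifP.
(* [C * (b - 1) <= b] and [b >= 3 / 2] force [C <= 3], hence [B <= 2]. Below, [C >= 2] and [pos]
   give [t >= 1 / 2], so that [b * b * t >= 1] and two factors [b] suffice. *)
have B2 : B <= 2.
  have : C * (b - 1) <= 3 * (b - 1) by lra.
  by rewrite ler_pM2r; lra.
have th : 1 / 2 <= t.
  have : 2 * (1 - t) <= C * (1 - t) by rewrite ler_wpM2r//; lra.
  lra.
have bb : 9 / 4 <= b * b.
  have : 3 / 2 * (3 / 2) <= b * b by apply: ler_pM => //; lra.
  lra.
have Vy : V / b / b <= y.
  have h1 : 1 / 2 * (9 / 4) <= t * (b * b) by apply: ler_pM => //; lra.
  have h2 : V * 1 <= V * (t * (b * b)) by rewrite ler_pM2l//; lra.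
  rewrite ler_pdivrMr// ler_pdivrMr// yt; lra.
have xP : b * b * t * x <= B * B * P y.
  rewrite -(ler_pM2r V0).
  have h0 : x <= B * (B * P (V / b / b)).
    by rewrite -PV (le_trans (Bsub _ V0))// ler_pM2l// Bsub.
  have h1 : b * b * (x * y) <= b * b * (B * (B * P (V / b / b)) * y).
    by rewrite ler_pM2l ?mulr_gt0// ler_wpM2r.
  have h2 : b * b * (B * (B * P (V / b / b)) * y) <= b * b * (B * (B * (V / b / b * P y))).
    rewrite ler_pM2l ?mulr_gt0// -!mulrA !ler_pM2l// !mulrA power_star//.
    by rewrite ltW// divr_gt0.
  have h3 : b * b * (B * (B * (V / b / b * P y))) = B * B * P y * V by field; rewrite gt_eqF.
  have h4 : b * b * (x * y) = b * b * t * x * V by rewrite yt; ring.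
  lra.
rewrite -CE; rewrite -(ler_pM2l (mulr_gt0 B0 B0)).
(* The difference is affine in [t] with slope [C * (B * B - b * b) >= 0], so only the endpoint
   [b * t = 1] matters; there [C >= 2 * b - 1] and [B <= 2] are used. *)
have h1 : B * B * (1 + C * (t - 1)) <= C * (b * b * t).
  rewrite -(ler_pM2l b0).
  have k1 : b * (4 * b - 2 * (b * b) - 1) <= b * (b / 3) by rewrite ler_pM2l//; nra.
  have k2 : b - C * (b - 1) <= b / 3.
    have : (2 * b - 1) * (b - 1) <= C * (b - 1) by rewrite ler_pM2r; lra.
    nra.
  have k3 : B * B * (b - C * (b - 1)) <= B * B * (b / 3) by rewrite ler_pM2l ?mulr_gt0.
  have k4 : B * B <= 2 * B by rewrite ler_pM2r.
  have k5 : B * B * (b / 3) <= C * (b * b).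
    have k6 : 9 / 2 * (2 * B - 1) <= 3 * b * (2 * B - 1) by rewrite ler_pM2r; lra.
    have k7 : b * (B * B) <= b * (3 * b * (2 * B - 1)) by rewrite ler_pM2l//; lra.
    rewrite CE; lra.
  have k8 : C * (B * B - b * b) * (b * t) <= C * (B * B - b * b) * 1.
    apply: ler_wpM2l; last exact: ltW.
    rewrite mulr_ge0 ?subr_ge0 ?ler_pM//; lra.
  lra.
have h2 : x * (B * B * (1 + C * (t - 1))) <= x * (C * (b * b * t)) by rewrite ler_pM2l.
have h3 : C * (b * b * t * x) <= C * (B * B * P y) by rewrite ler_pM2l//; lra.
lra.
Qed.

(** For [n < m] only the growth due to the other schedule matters, and each of its busy servers is
    charged to a job and to its own power. For [n >= m] the slopes are bounded below through
    [Q j <= V], and [ratio_scalar] is summed over the servers. *)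
Lemma drift_multi (N n no : nat) (y : 'I_m -> R) (V : R) : (n <= N)%N ->
  (forall k, 0 <= y k) -> (#|[pred k | y k != 0%R]| <= no)%N ->
  ((m <= n)%N -> P V = n%:R / m%:R) -> 0 <= V ->
  \sum_(i < N) (ratio_slope i.+1 - ratio_slope i) * excess_rate m n no (\sum_k y k) V i
    + n%:R - (minn m n)%:R <= (2 * B - 1) * (no%:R + \sum_k P (y k)).
Proof.
move=> nN y0 yno PV V0.
have C0 : 0 <= ratio_const by apply: le_trans C_ge2.
have mR : 0 < m%:R :> R by rewrite ltr0n.
have D0 : ratio_slope 0 = 0 by rewrite /ratio_slope mul0r mul0r mulr0.
have Y0 : 0 <= \sum_k y k by apply: sumr_ge0.
have SP0 : 0 <= \sum_k P (y k) by apply: sumr_ge0 => k _; exact: power_ge0.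
have no0 : 0 <= no%:R :> R by [].
have H := sum_excess_rate_le D0 ratio_slope_homo m no nN Y0 V0.
rewrite -addrA (le_trans (lerD H (lexx _)))//.
have [mn|nm] := leqP m n; last first.
  rewrite subrr addr0.
  have HD : 0 <= V * \sum_(k < m) ratio_slope (n - no - k).
    by rewrite mulr_ge0// sumr_ge0// => k _; rewrite -D0 ratio_slope_homo.
  have K : ratio_const * (no%:R + \sum_k P (y k)) <= (2 * B - 1) * (no%:R + \sum_k P (y k)).
    by rewrite ler_wpM2r ?addr_ge0.
  suff : (\sum_k y k) * ratio_slope n <= ratio_const * (no%:R + \sum_k P (y k)) by lra.
  have : \sum_k (y k * ratio_slope n) <= \sum_k (ratio_const * ((y k != 0)%:R + P (y k))).
    apply: ler_sum => k _; rewrite /ratio_slope mulrCA ler_wpM2l//.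
    have [->|yk0] := eqVneq (y k) 0; first by rewrite mul0r P0 addr0.
    have Pk := power_ge0 (y0 k).
    case: (posnP n) => [->|n0]; first by rewrite !mul0r mulr0 addr_ge0.
    have Qn := Q_gt0 m0 n0.
    have x1 : n%:R / m%:R <= 1 :> R by rewrite ler_pdivrMr// mul1r ler_nat ltnW.
    have [yQ|/ltW Qy] := leP (y k) (Q n).
      have h1 : n%:R / m%:R * (y k / Q n) <= n%:R / m%:R * 1.
        by apply: ler_wpM2l; [rewrite divr_ge0|rewrite ler_pdivrMr// mul1r].
      rewrite mulrCA/=; lra.
    rewrite -PQ mulrA ler_pdivrMr//.
    have := power_star (Q_ge0 n) Qy; have : 0 <= Q n * (1%:R) by rewrite mulr_ge0.
    rewrite /=; lra.
  rewrite -mulr_suml -mulr_sumr big_split/= => /le_trans; apply.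
  rewrite ler_wpM2l// lerD2r -natr_sum ler_nat (leq_trans _ yno)//.
  by rewrite -sum1_card [leqRHS]big_mkcond/=; apply: leq_sum => k _; rewrite inE; case: (_ != _).
have n0 : (0 < n)%N by apply: leq_trans mn.
have {}PV := PV mn.
have VQ : V = Q n by apply: power_inj => //; rewrite PQ PV.
have Vp : 0 < V by rewrite VQ Q_gt0.
pose x : R := n%:R / m%:R.
have x1 : 1 <= x by rewrite ler_pdivlMr// mul1r ler_nat.
have DV j : (j <= n)%N -> ratio_const * (j%:R / m%:R) <= V * ratio_slope j.
  move=> jn; case: (posnP j) => [->|j0].
    by rewrite D0 mul0r !mulr0.
  have Qj := Q_gt0 m0 j0.
  rewrite /ratio_slope [leRHS]mulrCA ler_wpM2l// [leRHS]mulrCA ler_peMr ?divr_ge0//.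
  by rewrite ler_pdivlMr// mul1r VQ Q_le.
(* The levels [n - no - k] form an arithmetic progression whose mean lies [(m - 1) / 2] below
   [n - no]; truncated subtraction only increases them. *)
have HD : ratio_const * (n%:R - no%:R - (m%:R - 1) / 2) <= V * \sum_(k < m) ratio_slope (n - no - k).
  have gauss (u v : R) p : \sum_(k < p) ((u - k%:R) * v) = (p%:R * u - p%:R * (p%:R - 1) / 2) * v.
    elim: p => [|p IH]; first by rewrite big_ord0; ring.
    by rewrite big_ord_recr/= IH -natr1; field.
  have : \sum_(k < m) ratio_const * ((n%:R - no%:R - k%:R) / m%:R) <=
         \sum_(k < m) V * ratio_slope (n - no - k).
    apply: ler_sum => k _; apply: le_trans (DV _ _); last by rewrite -subnDA leq_subr.
    rewrite ler_wpM2l// ler_pM2r ?invr_gt0// -subnDA.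
    have := leq_subK n (no + k); rewrite -(ler_nat R) !natrD; lra.
  rewrite -[leLHS]mulr_sumr -[leRHS]mulr_sumr.
  rewrite gauss; suff -> : (m%:R * (n%:R - no%:R) - m%:R * (m%:R - 1) / 2) / m%:R =
      n%:R - no%:R - (m%:R - 1) / 2 :> R by [].
  by move: (m%:R : R) mR (n%:R : R) (no%:R : R) => M M0 u v; field; rewrite gt_eqF.
have HY : (\sum_k y k) * ratio_slope n = \sum_k (ratio_const * x * (y k / V)).
  by rewrite mulr_suml; apply: eq_bigr => k _; rewrite /ratio_slope -VQ /x; ring.
have : \sum_(k < m) (ratio_const * x * (y k / V) - ratio_const * x
     + ratio_const * (b - 1) / 2 + x - 1) <= \sum_(k < m) (2 * B - 1) * P (y k).
  by apply: ler_sum => k _; apply: ratio_scalar.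
have sumC (c : R) : \sum_(k < m) c = m%:R * c.
  by rewrite sumr_const card_ord mulr_natl.
rewrite -[X in _ <= X -> _]mulr_sumr !big_split/= !sumrN -HY !sumC.
have mV : m%:R * m%:R^-1 = 1 :> R by rewrite mulfV// gt_eqF.
have e1 : m%:R * x = n%:R by rewrite /x mulrC divfK// gt_eqF.
(* This identity explains [b = 2 - 1 / m]: the loss of the arithmetic progression is spread evenly
   over the servers. *)
have e2 : m%:R * (b - 1) = m%:R - 1.
  rewrite /b; move: (m%:R : R) (m%:R^-1 : R) mV => M M'; lra.
have e3 : m%:R * (ratio_const * x) = ratio_const * n%:R by rewrite mulrCA e1.
have e4 : m%:R * (ratio_const * (b - 1) / 2) = ratio_const * (m%:R - 1) / 2.
  by rewrite -e2 !mulrA [m%:R * _]mulrC.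
rewrite e1 e3 e4 mulr1 => K.
have K2 : ratio_const * no%:R <= (2 * B - 1) * no%:R by rewrite ler_wpM2r.
lra.
Qed.

End PowerFunction.

(** The term with factor [1 / s1] is the drift of the total remaining sizes: it returns [minn m n],
    because [V >= s1], and costs at most [no] plus the power, by [speed_le]. The resulting [2 * B]
    is at most [B * (1 + 1 / s1)], because [s1 <= 1]. *)
Lemma drift_weights {R : realFieldType} (P : R -> R) (s1 : R) (m N : nat) (Q : nat -> R) :
  P 0 = 0 -> (forall x y, 0 <= x -> x < y -> P x < P y) ->
  (forall x y l, 0 <= x -> 0 <= y -> x != y -> 0 < l -> l < 1 ->
      P (l * x + (1 - l) * y) < l * P x + (1 - l) * P y) ->
  (forall x y, 0 < x -> 0 < y -> P (x * y) <= P x * P y) ->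
  0 <= s1 -> P s1 = 1 -> (0 < m)%N ->
  (forall i, 0 <= Q i) -> (forall i, P (Q i) = i%:R / m%:R) ->
  exists c : 'I_N -> R, (forall i, 0 <= c i) /\
    forall (n no : nat) (y : 'I_m -> R) (V : R), (n <= N)%N -> (forall k, 0 <= y k) ->
    (#|[pred k | y k != 0%R]| <= no)%N -> 0 <= V ->
    P V = (if (m <= n)%N then n%:R / m%:R else 1) ->
    \sum_i c i * excess_rate m n no (\sum_k y k) V i
      + s1^-1 * (\sum_k y k - (minn m n)%:R * V)
    <= P (2 - m%:R^-1) * (1 + s1^-1) * (no%:R + \sum_k P (y k)) - n%:R.
Proof.
move=> P0 Pi Pc Ps Hs1 Ps1 m0 Q0 PQ.
have s10 := power_s1_gt0 P0 Hs1 Ps1.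
have s11 := power_s1_le1 P0 Pi Ps Ps1.
have P1 := power1_ge1 P0 Pi Ps.
have Pge0 := power_ge0 P0 Pi.
set B := P (2 - m%:R^-1).
have B1 : 1 <= B.
  apply: le_trans P1 _; apply: (power_le Pi) => //.
  have : (m%:R : R)^-1 <= 1 by rewrite invf_le1 ?ltr0n// ler1n.
  lra.
have [c [c0 Hc]] : exists c : 'I_N -> R, (forall i, 0 <= c i) /\
    forall (n no : nat) (y : 'I_m -> R) (V : R), (n <= N)%N -> (forall k, 0 <= y k) ->
    (#|[pred k | y k != 0%R]| <= no)%N -> 0 <= V ->
    ((m <= n)%N -> P V = n%:R / m%:R) ->
    \sum_i c i * excess_rate m n no (\sum_k y k) V i + n%:R - (minn m n)%:R
      <= (2 * B - 1) * (no%:R + \sum_k P (y k)).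
  have [m2|] := ltnP 1 m.
    have hom := ratio_slope_homo P0 Pi Pc Ps Q0 PQ m2.
    exists (fun i : 'I_N => ratio_slope P m Q i.+1 - ratio_slope P m Q i).
    split=> [i|n no y V nN y0 yno V0 PV]; first by rewrite subr_ge0 hom.
    exact: (drift_multi P0 Pi Pc Ps Q0 PQ m2).
  move=> m1; have {}m1 : m = 1%N by apply/eqP; rewrite eqn_leq m1.
  have hom := chord_slope_homo Pi Pc Q0 PQ m1.
  exists (fun i : 'I_N => chord_slope Q i.+1 - chord_slope Q i).
  split=> [i|n no y V nN y0 yno V0 PV]; first by rewrite subr_ge0 hom.
  have Y0 : 0 <= \sum_k y k by exact: sumr_ge0.
  have PV' : n != 0%N -> P V = n%:R / m%:R by move=> n0; apply: PV; rewrite m1 lt0n.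
  have PY : P (\sum_k y k) = \sum_k P (y k).
    by move: y {y0 yno Y0}; rewrite m1 => y; rewrite !big_ord1.
  apply: (le_trans (drift_single P0 Pi Pc Q0 PQ no m1 nN Y0 PV' V0)).
  rewrite PY -[leLHS]mul1r ler_wpM2r//; last by lra.
  by rewrite addr_ge0// sumr_ge0// => k _; exact: Pge0.
exists c; split=> // n no y V nN y0 yno V0 PV.
have S0 : 0 <= \sum_k P (y k) by rewrite sumr_ge0// => k _; exact: Pge0.
have sV : s1 <= V.
  apply: (power_le_inv Pi) => //; rewrite Ps1 PV; case: ifP => // mn.
  by rewrite ler_pdivlMr ?ltr0n// mul1r ler_nat.
have PV' : (m <= n)%N -> P V = n%:R / m%:R by move=> mn; rewrite PV mn.
have h1 := Hc n no y V nN y0 yno V0 PV'.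
have h2 : s1^-1 * \sum_k y k <= no%:R + \sum_k P (y k).
  rewrite ler_pdivrMl//.
  apply: (le_trans (ler_sum _ (fun k _ => speed_le P0 Pi Pc Hs1 Ps1 (y0 k)))).
  rewrite -mulr_sumr ler_pM2l// big_split/= lerD2r -natr_sum ler_nat (leq_trans _ yno)//.
  by rewrite -sum1_card [leqRHS]big_mkcond/=; apply: leq_sum => k _; rewrite inE; case: (_ != _).
have h3 : (minn m n)%:R <= s1^-1 * ((minn m n)%:R * V).
  rewrite ler_pdivlMl// mulrC ler_wpM2l//.
have s1V : 1 <= s1^-1 by rewrite invf_ge1.
have h4 : 2 * B * (no%:R + \sum_k P (y k)) <= B * (1 + s1^-1) * (no%:R + \sum_k P (y k)).
  rewrite ler_wpM2r ?addr_ge0// mulrC ler_pM2l//; lra.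
move: h1 h2 h3 h4; rewrite mulrBr.
move: (\sum_i c i * _) (\sum_k P _) (s1^-1 * \sum_k y k) => x1 x2 x3.
move: (s1^-1 * (_ * V)) (B * (1 + s1^-1) * _) => x4 x5; lra.
Qed.

From mathcomp Require Import all_classical all_reals all_analysis.
From mathcomp Require Import measurable_realfun.
Import Order.TTheory GRing.Theory Num.Theory.
Import numFieldNormedType.Exports.
Local Open Scope classical_set_scope.
Local Open Scope ring_scope.

(** * A one-sided fundamental theorem of calculus *)

Section OneSidedFTC.
Context {R : realType}.
Notation mu := (@lebesgue_measure R).
Implicit Types (f g r rho : R -> R) (x y z : R).

Definition incr f x y : R := (\int[mu]_(t in `]x, y]) f t)%R.

Lemma integrable_sub f (A : set R) : measurable A ->
  mu.-integrable setT (EFin \o f) -> mu.-integrable A (EFin \o f).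
Proof. by move=> mA; apply: integrableS. Qed.

Lemma integrable_normr_fun f (A : set R) : mu.-integrable A (EFin \o f) ->
  mu.-integrable A (EFin \o (fun t => `|f t|)).
Proof.
move=> fi; rewrite (_ : _ \o _ = abse \o (EFin \o f)); last exact/funext.
exact: integrable_abse.
Qed.

Lemma integrable_addr f g (A : set R) : measurable A ->
  mu.-integrable A (EFin \o f) -> mu.-integrable A (EFin \o g) ->
  mu.-integrable A (EFin \o (fun t => f t + g t)).
Proof.
move=> mA fi gi; rewrite (_ : _ \o _ = (EFin \o f) \+ (EFin \o g))%E; last exact/funext.
exact: integrableD.
Qed.

Lemma integrable_subr f g (A : set R) : measurable A ->
  mu.-integrable A (EFin \o f) -> mu.-integrable A (EFin \o g) ->
  mu.-integrable A (EFin \o (fun t => f t - g t)).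
Proof.
move=> mA fi gi; rewrite (_ : _ \o _ = (EFin \o f) \- (EFin \o g))%E; last exact/funext.
exact: integrableB.
Qed.

Lemma integrable_mulr f (k : R) (A : set R) : measurable A ->
  mu.-integrable A (EFin \o f) -> mu.-integrable A (EFin \o (fun t => k * f t)).
Proof.
move=> mA fi; rewrite (_ : _ \o _ = (fun t => k%:E * (EFin \o f) t)%E); last exact/funext.
exact: integrableZl.
Qed.

Lemma integrable_bounded_itv f x y (M : R) : measurable_fun setT f ->
  (forall t, `|f t| <= M) -> mu.-integrable `[x, y] (EFin \o f).
Proof.
move=> mf fM; apply: measurable_bounded_integrable => //.
- rewrite [X in (X < _)%E](lebesgue_measure_itv `[x, y])/=.
  by case: ifP => _; rewrite ?ltry// -EFinB ltry.
- exact: measurable_funS mf.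
- exists M; split; first exact: num_real.
  by move=> M' /ltW MM' t _; exact: le_trans MM'.
Qed.

Lemma incr_cat f x y z : mu.-integrable setT (EFin \o f) -> x <= y -> y <= z ->
  incr f x z = incr f x y + incr f y z.
Proof.
move=> fi xy yz; apply/eqP; rewrite addrC -subr_eq; apply/eqP.
rewrite /incr Rintegral_itvB//=; exact: integrable_sub.
Qed.

Lemma incrNy f x y : mu.-integrable setT (EFin \o f) -> x <= y ->
  incr f x y = (\int[mu]_(t in `]-oo, y]) f t - \int[mu]_(t in `]-oo, x]) f t)%R.
Proof.
move=> fi xy; rewrite /incr Rintegral_itvB//=; exact: integrable_sub.
Qed.

Lemma incr_ge0 f x y : (forall t, 0 <= f t) -> 0 <= incr f x y.
Proof. by move=> f0; apply: Rintegral_ge0. Qed.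

Lemma incrxx f x : incr f x x = 0.
Proof. by rewrite /incr set_itv_ge ?Rintegral_set0// bnd_simp ltxx. Qed.

Lemma incrD f g x y :
  mu.-integrable setT (EFin \o f) -> mu.-integrable setT (EFin \o g) ->
  incr (fun t => f t + g t) x y = incr f x y + incr g x y.
Proof. by move=> fi gi; rewrite /incr RintegralD//; exact: integrable_sub. Qed.

Lemma incrZ (c : R) f x y : mu.-integrable setT (EFin \o f) ->
  incr (fun t => c * f t) x y = c * incr f x y.
Proof. by move=> fi; rewrite /incr RintegralZl//; exact: integrable_sub. Qed.

Lemma incr_sum (I : finType) (p : pred I) (f : I -> R -> R) x y :
  (forall i, mu.-integrable setT (EFin \o f i)) ->
  incr (fun t => \sum_(i | p i) f i t) x y = \sum_(i | p i) incr (f i) x y.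
Proof.
move=> fi; rewrite /incr /Rintegral; under eq_integral do rewrite -sumEFin.
rewrite integral_sum//; last by move=> i; exact: integrable_sub.
rewrite sum_fine// => i _; exact/integrable_fin_num/integrable_sub.
Qed.

Lemma integrable_Rsum (I : finType) (p : pred I) (f : I -> R -> R) (A : set R) :
  measurable A -> (forall i, mu.-integrable A (EFin \o f i)) ->
  mu.-integrable A (EFin \o (fun t => \sum_(i | p i) f i t)).
Proof.
move=> mA fi; rewrite (_ : _ \o _ = (fun t => \sum_(i <- index_enum I | p i) (EFin \o f i) t)%E).
  exact: integrable_sum.
by apply/funext => t /=; rewrite sumEFin.
Qed.

(** The indefinite integral of [f] has right derivative [a] at [t]. *)
Definition has_density f (a : R) (t : R) := forall e, 0 < e ->
  exists2 d, 0 < d & forall h, 0 < h -> h < d -> `|incr f t (t + h) - a * h| <= e * h.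

(** Lebesgue differentiation of the integral from [-oo], restricted to right increments. *)
Lemma ae_density f : mu.-integrable setT (EFin \o f) ->
  {ae mu, forall t, has_density f (f t) t}.
Proof.
move=> fi; have locf : locally_integrable setT f.
  by apply: open_integrable_locally => //; exact: openT.
have := FTC1Ny (fun y => integrable_sub (measurable_itv _) fi) locf.
apply: (@filterS _ _ (ae_filter_ringOfSetsType mu)) => t /= [/cvg_ex[/= l Fl] Ft] e e0.
have {Ft}lE : l = f t.
  by rewrite -Ft derive1E; apply/esym; exact: (cvg_lim (@Rhausdorff R) Fl).
rewrite {l}lE in Fl; move/cvgrPdist_le : Fl => /(_ _ e0)[d /= d0 H].
exists d => // h h0 hd.
have := H h; rewrite /ball/= sub0r normrN gtr0_norm// => /(_ hd (lt0r_neq0 h0)).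
rewrite [h%:A]mulr1 (addrC h t) incrNy//; last by rewrite lerDl ltW.
set F := (X in h^-1 *: X) => Fh.
rewrite (_ : _ - _ = (h^-1 * F - f t) * h); last by rewrite /F; field; rewrite gt_eqF.
by rewrite normrM (gtr0_norm h0) ler_pM2r// distrC.
Qed.

Lemma incr_small f : mu.-integrable setT (EFin \o f) -> (forall t, 0 <= f t) ->
  forall e, 0 < e -> exists2 d, 0 < d &
    forall x y, y - x < d -> incr f x y < e.
Proof.
move=> fi f0 e e0; have [d [d0 H]] := integral_normr_continuous fi e0.
exists d => // x y yx.
have -> : incr f x y = (\int[mu]_(t in `]x, y]) `|f t|)%R.
  by apply: eq_Rintegral => t _; rewrite ger0_norm.
apply: H; first exact: measurable_itv.
rewrite [X in (X < _)%E](lebesgue_measure_itv `]x, y])/=; case: ifPn => _; last by rewrite lte_fin.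
by rewrite -EFinB lte_fin.
Qed.

(* Real induction: the exceptional null set is enclosed in an open set on which
   the one-sided modulus [rho] integrates to at most [e]. *)
Lemma le_incr_dini (a b : R) f rho r : a <= b ->
  mu.-integrable setT (EFin \o rho) -> mu.-integrable setT (EFin \o r) ->
  (forall t, 0 <= rho t) ->
  (forall x y, a <= x -> x <= y -> y <= b -> f y - f x <= incr rho x y) ->
  {ae mu, forall t, a < t -> t < b -> forall e, 0 < e ->
    exists2 d, 0 < d & forall h, 0 < h -> h < d -> f (t + h) - f t <= (r t + e) * h} ->
  f b - f a <= incr r a b.
Proof.
move=> ab irho ir rho0 frho fdini.
have [N [mN N0 Ndini]] : {ae mu, forall t, a < t -> t < b -> forall e, 0 < e ->
    exists2 d, 0 < d & forall h, 0 < h -> h < d ->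
     (f (t + h) - f t) - incr r t (t + h) <= e * h}.
  apply: (@filterS2 _ _ (ae_filter_ringOfSetsType mu) _ _ _ _ fdini (ae_density ir)) => t H1 H2 ta tb e e0.
  have e2 : 0 < e / 2 by rewrite divr_gt0.
  have [d1 d10 {}H1] := H1 ta tb _ e2; have [d2 d20 {}H2] := H2 _ e2.
  exists (Num.min d1 d2); first by rewrite lt_min d10.
  move=> h h0; rewrite lt_min => /andP[hd1 hd2].
  have := H1 h h0 hd1; have := H2 h h0 hd2; rewrite ler_norml => /andP[+ _].
  lra.
pose g t := f t - f a - incr r a t.
have gE x y : a <= x -> x <= y -> g y - g x = f y - f x - incr r x y.
  by move=> ax xy; rewrite /g (incr_cat ir ax xy); ring.
pose rh t := rho t + `|r t|.
have irh : mu.-integrable setT (EFin \o rh).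
  by apply: integrable_addr => //; exact: integrable_normr_fun.
have rh0 t : 0 <= rh t by rewrite addr_ge0.
have grh x y : a <= x -> x <= y -> y <= b -> g y - g x <= incr rh x y.
  move=> ax xy yb; rewrite gE// /rh incrD//; last first.
    exact: integrable_normr_fun.
  rewrite lerD ?frho// (le_trans (ler_norm _))// normrN.
  by rewrite le_normr_Rintegral//; exact: integrable_sub.
apply/ler_addgt0Pr => e e0.
(* [c] serves both as slack in the slope and as bound for the integral over the exceptional open
   set. *)
have [c c0 ec] : exists2 c, 0 < c & c * (b - a) + c <= e.
  have p : 0 < b - a + 1 by lra.
  exists (e / (b - a + 1)); first by rewrite divr_gt0.
  by rewrite -[X in _ + X]mulr1 -mulrDr divfK// gt_eqF.
have [d [d0 Hd]] := integral_normr_continuous irh c0.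
(* The point [a] joins the null set because the derivative bound is assumed for [t > a] only. *)
have muN : mu (N `|` [set a]) = 0%E.
  have H1 : (mu N <= 0)%E by rewrite N0.
  have H2 : (mu [set a] <= 0)%E by rewrite lebesgue_measure_set1.
  apply/eqP; rewrite -measure_le0 (le_trans (measureU2 _ _ _))//.
  by rewrite -(adde0 0%E); exact: leeD.
have mNa : measurable (N `|` [set a]) by exact: measurableU.
have [U [oU NU Ud]] : exists U : set R, [/\ open U, N `|` [set a] `<=` U & (mu U < d%:E)%E].
  have muNoo : (mu (N `|` [set a]) < +oo)%E by rewrite muN.
  have [U [oU NU UN]] := lebesgue_regularity_outer mNa muNoo d0.
  exists U; split=> //; apply: le_lt_trans UN.
  rewrite -[X in (mu X <= _)%E](setDUK NU) (le_trans (measureU2 _ _ _))//.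
    by apply: measurableD => //; exact: open_measurable.
  have H1 : (mu (N `|` [set a]) <= 0)%E by rewrite muN.
  by rewrite -[leRHS]add0e; exact: leeD.
have mU := open_measurable oU.
pose u := rh \_ U.
have iu : mu.-integrable setT (EFin \o u).
  rewrite /u -restrict_EFin; apply/integrable_restrict => //.
  by rewrite setTI; exact: integrable_sub.
have u0 t : 0 <= u t by rewrite /u patchE; case: ifP.
have uc x y : incr u x y <= c.
  rewrite /incr /u -Rintegral_mkcondr.
  rewrite (_ : (\int[mu]_(t in _) _)%R =
      (\int[mu]_(t in `]x, y] `&` U) `|rh t|)%R); last first.
    by apply: eq_Rintegral => t _; rewrite ger0_norm.
  apply/ltW/Hd; first exact: measurableI.
  by rewrite (le_lt_trans _ Ud)// le_measure ?inE//; exact: measurableI.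
suff : g b <= c * (b - a) + incr u a b.
  rewrite /g => H; have := uc a b; lra.
(* Real induction: the supremum of [S] belongs to [S], and if it were below [b], [S] would have a
   larger element. *)
pose S := [set t | a <= t <= b /\ g t <= c * (t - a) + incr u a t].
have Sa : S a by split; rewrite ?lexx// /g !incrxx !subrr mulr0 addr0.
have Sb : has_sup S by split; [exists a|exists b => t [/andP[]]].
pose T := sup S.
have aT : a <= T by apply: ub_le_sup Sa; exact: Sb.2.
have Tb : T <= b by apply: ge_sup; [exists a|move=> t [/andP[]]].
have ST : S T.
  split; first by rewrite aT.
  apply/ler_addgt0Pr => eta eta0.
  (* [g] may jump down but rises by at most the small integral of [rh], so the bound passes to the
     supremum. *)
  have [dd dd0 Hdd] := incr_small irh rh0 eta0.
  have [t [/andP[ta tb] gt] Tt] := sup_adherent dd0 Sb.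
  have tT : t <= T by apply: ub_le_sup; [exact: Sb.2|split=> //; rewrite ta].
  have := grh _ _ ta tT Tb; have := Hdd t T; rewrite ltrBlDr -ltrBlDl -/T => /(_ Tt).
  rewrite (incr_cat iu ta tT) => h1 h2.
  have := incr_ge0 t T u0.
  have : c * (t - a) <= c * (T - a) by rewrite ler_pM2l// lerB.
  lra.
have [bT|Tltb] := leP b T.
  have -> : b = T by apply/eqP; rewrite eq_le bT Tb.
  exact: ST.2.
exfalso.
have ext t : T < t -> t <= b -> g t - g T <= c * (t - T) + incr u T t -> False.
  move=> Tt tb H; have : t <= T.
    apply: ub_le_sup; first exact: Sb.2.
    split; first by rewrite tb (le_trans aT)// ltW.
    rewrite (incr_cat iu aT (ltW Tt)); have := ST.2; lra.
  by rewrite leNgt Tt.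
(* Inside the open set [u] equals the modulus [rh], which covers the growth; outside, [T] is neither
   [a] nor exceptional, and the slope bound with slack [c] applies. *)
have [UT|UT] := pselect (U T).
  have /nbhs_ballP[eta /= eta0 HU] := open_nbhs_nbhs (conj oU UT).
  pose h := Num.min (eta / 2) (b - T).
  have h0 : 0 < h by rewrite lt_min divr_gt0// subr_gt0.
  have hb : T + h <= b by rewrite -lerBrDl /h ge_min lexx orbT.
  have he : h < eta by rewrite (le_lt_trans (_ : _ <= eta / 2))// ?ge_min ?lexx//; lra.
  apply: (ext (T + h)) => //; first by rewrite ltrDl.
  rewrite (le_trans (grh _ _ _ _ _))//; first by rewrite lerDl ltW.
  have -> : incr u T (T + h) = incr rh T (T + h).
    apply: eq_Rintegral => t; rewrite inE/= in_itv/= => /andP[Tt th].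
    rewrite /u patchE mem_set//; apply: HU; rewrite /ball/= ltr_norml.
    apply/andP; split; lra.
  by rewrite lerDr mulr_ge0 ?(ltW c0)//; lra.
have Ta : a < T.
  rewrite lt_neqAle aT andbT; apply/eqP => Ta; apply: UT; apply: NU.
  by right; rewrite /= Ta.
have [] : (exists2 d, 0 < d & forall h, 0 < h -> h < d ->
     (f (T + h) - f T) - incr r T (T + h) <= c * h).
  apply: contrapT => H; apply: UT; apply: NU; left; apply: Ndini => /= K.
  by apply: H; apply: K.
move=> eta eta0 H.
pose h := Num.min (eta / 2) (b - T).
have h0 : 0 < h by rewrite lt_min divr_gt0// subr_gt0.
have hb : T + h <= b by rewrite -lerBrDl /h ge_min lexx orbT.
have he : h < eta by rewrite (le_lt_trans (_ : _ <= eta / 2))// ?ge_min ?lexx//; lra.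
apply: (ext (T + h)) => //; first by rewrite ltrDl.
rewrite gE//; last by rewrite lerDl ltW.
rewrite (le_trans (H _ h0 he))// addrAC subrr add0r lerDl; exact: incr_ge0.
Qed.

End OneSidedFTC.

(** * The potential along two schedules *)

Section Trajectory.
Context {R : realType} {N : nat}.
Variables (a w : 'I_N -> R).
Hypothesis w0 : forall j, 0 < w j.
Notation mu := (@lebesgue_measure R).
Implicit Types (r : 'I_N -> R -> R) (j : 'I_N) (t h e : R).

(** The truncation at zero allows for a schedule that keeps working on a finished job; unreleased
    jobs count as zero, so a release is an upward jump. *)
Definition rem r t j : R :=
  if a j <= t then Num.max 0 (w j - \int[mu]_(u in `]-oo, t]) r j u)%R else 0.

Definition rates_ok r := [/\ forall j u, 0 <= r j u,
  forall j, mu.-integrable setT (EFin \o r j) & forall j u, u < a j -> r j u = 0].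

Definition released t t' j := (t < a j) && (a j <= t').

Lemma rem_ge0 r t j : 0 <= rem r t j.
Proof. by rewrite /rem; case: ifP => // _; rewrite le_max lexx. Qed.

Lemma rem_le_released r t t' j : rates_ok r -> t <= t' ->
  rem r t' j <= rem r t j + (if released t t' j then w j else 0).
Proof.
move=> [r0 ri ra] tt'; rewrite /rem /released.
case: (leP (a j) t) => [at_|ta] /=.
  rewrite (le_trans at_ tt') addr0 ge_max !le_max lexx/=; apply/orP; right.
  rewrite lerD2l lerN2 -subr_ge0 -incrNy//; exact: incr_ge0.
rewrite add0r; case: ifP => // _.
rewrite ge_max ltW//= gerBl; exact: Rintegral_ge0.
Qed.

Lemma maxr0B_le (v x y : R) : 0 <= y - x ->
  Num.max 0 (v - x) <= y - x + Num.max 0 (v - y).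
Proof.
move=> yx; have h1 : 0 <= Num.max 0 (v - y) by rewrite le_max lexx.
have h2 : v - y <= Num.max 0 (v - y) by rewrite le_max lexx orbT.
by rewrite ge_max; apply/andP; split; lra.
Qed.

Lemma released_le_rem r t t' j : rates_ok r -> t <= t' ->
  rem r t j + (if released t t' j then w j else 0) <= rem r t' j + incr (r j) t t'.
Proof.
move=> [r0 ri ra] tt'; rewrite incrNy//; rewrite /rem /released.
have I0 u : u < a j -> (\int[mu]_(v in `]-oo, u]) r j v)%R = 0.
  move=> ua; rewrite /Rintegral integral0_eq// => v /=; rewrite in_itv/= => vu.
  by rewrite ra//; exact: le_lt_trans ua.
have : 0 <= incr (r j) t t' by exact: incr_ge0.
rewrite incrNy//.
case: (leP (a j) t) => [at_|ta] /=.
  rewrite (le_trans at_ tt') addr0.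
  by move=> H; rewrite [leRHS]addrC; exact: maxr0B_le.
case: ifP => [at'|/negbT]; last first.
  by rewrite -ltNge => /I0 ->; rewrite I0// subrr !addr0 lexx.
rewrite add0r (I0 t)// => H; have := maxr0B_le (w j) H; rewrite subr0 => H'.
by rewrite [leRHS]addrC; apply: le_trans H'; rewrite le_max lexx orbT.
Qed.

(** Releases are treated before work: [q'] adds the new jobs to the sizes of the other schedule,
    which [drop_sum_release] covers, and the work of that schedule then costs at most its total
    amount. *)
Lemma excess_release r r' i t t' : rates_ok r -> rates_ok r' -> t <= t' ->
  excess i (rem r t') (rem r' t') <=
  excess i (rem r t) (rem r' t) + \sum_j incr (r' j) t t'.
Proof.
move=> rok r'ok tt'.
have inc0 j : 0 <= incr (r' j) t t' by apply: incr_ge0; case: r'ok.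
have S0 : 0 <= \sum_j incr (r' j) t t' by exact: sumr_ge0.
apply: excess_le; first by rewrite addr_ge0 ?excess_ge0.
move=> k kN; pose M := [set j | released t t' j]%SET.
pose q' j := rem r' t j + (if released t t' j then w j else 0).
have [||||||l lk] := @drop_sum_release R _ i k (rem r t) (rem r' t) (rem r t') q' w M.
- by move=> j; exact: ltW.
- by move=> j; rewrite inE /rem => /andP[]; rewrite ltNge => /negbTE->.
- exact: rem_ge0.
- exact: rem_ge0.
- by move=> j; rewrite inE; exact: rem_le_released.
- by move=> j; rewrite inE.
have := le_excess i (rem r t) (rem r' t) (leq_trans lk kN).
have := @drop_sum_leD R _ k q' (rem r' t') (fun j => incr (r' j) t t') inc0
  (fun j => released_le_rem j r'ok tt').
lra.
Qed.

Variables (rA rO : 'I_N -> R -> R).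
Hypotheses (okA : rates_ok rA) (okO : rates_ok rO).
Variables (c : 'I_N -> R) (c0 : R).
Hypotheses (c_ge0 : forall i, 0 <= c i) (c0_ge0 : 0 <= c0).

Definition potential t : R :=
  \sum_i c i * excess i (rem rA t) (rem rO t) +
  c0 * (\sum_j rem rA t j - \sum_j rem rO t j).

(** Crude but valid across releases, this bound ignores the work of the algorithm; it supplies the
    modulus [rho] of [le_incr_dini]. *)
Lemma potential_incr t t' : t <= t' -> potential t' - potential t <=
  incr (fun u => (\sum_i c i + c0) * \sum_j rO j u) t t'.
Proof.
move=> tt'; have [rO0 rOi _] := okO.
rewrite incrZ; last exact: integrable_Rsum.
rewrite incr_sum//.
set S := \sum_j incr (rO j) t t'.
have H1 : \sum_i c i * excess i (rem rA t') (rem rO t') <=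
   \sum_i c i * excess i (rem rA t) (rem rO t) + (\sum_i c i) * S.
  rewrite mulr_suml -big_split/=; apply: ler_sum => i _.
  by rewrite -mulrDr ler_wpM2l// excess_release.
have H2 : \sum_j rem rA t' j - \sum_j rem rO t' j <=
    \sum_j rem rA t j - \sum_j rem rO t j + S.
  have := ler_sum (index_enum 'I_N) (fun j (_ : true) => rem_le_released j okA tt').
  have := ler_sum (index_enum 'I_N) (fun j (_ : true) => released_le_rem j okO tt').
  rewrite !big_split/= -/S; lra.
have H3 : c0 * (\sum_j rem rA t' j - \sum_j rem rO t' j) <=
    c0 * (\sum_j rem rA t j - \sum_j rem rO t j + S) by rewrite ler_wpM2l.
rewrite /potential; lra.
Qed.

Lemma common_delta (Q : 'I_N -> R -> Prop) :
  (forall j, exists2 d, 0 < d & forall h, 0 < h -> h < d -> Q j h) ->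
  exists2 d : R, 0 < d & forall j h, 0 < h -> h < d -> Q j h.
Proof.
move=> /= H.
have /choice[d dP] : forall j, exists d : R, 0 < d /\ forall h, 0 < h -> h < d -> Q j h.
  by move=> j; have [d d0 dQ] := H j; exists d.
exists (\big[Num.min/1]_j d j).
  by apply: lt_bigmin => // j _; case: (dP j).
move=> j h h0 hd; apply: (dP j).2 => //; apply: (lt_le_trans hd); exact: bigmin_le.
Qed.

Variable m : nat.
Hypothesis m0 : (0 < m)%N.

(** For small [h] nothing is released during the step, no served job runs out, and the work done is
    [h] times the rates up to a small error, so [excess_step] applies to every level. *)
Lemma potential_dini t (S : {set 'I_N}) (V : R) :
  let U := [set j | rem rA t j != 0]%SET in
  let UO := [set j | rem rO t j != 0]%SET in
  let Y := \sum_(j in UO) rO j t in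
  (forall j, has_density (rA j) (rA j t) t) ->
  (forall j, has_density (rO j) (rO j t) t) ->
  0 <= V -> (S \subset U)%SET -> #|S| = minn m #|U| ->
  (forall x y, x \in S -> y \in U -> y \notin S -> rem rA t x <= rem rA t y) ->
  (forall j, j \in S -> rA j t = V) ->
  forall e, 0 < e -> exists2 d, 0 < d & forall h, 0 < h -> h < d ->
    potential (t + h) - potential t <=
    (\sum_i c i * excess_rate m #|U| #|UO| Y V i + c0 * (Y - (minn m #|U|)%:R * V) + e) * h.
Proof.
move=> U UO Y dA dO V0 SU cS Smin SV e e0.
have [rA0 rAi rAa] := okA; have [rO0 rOi rOa] := okO.
(* [Cc] collects the coefficients of [e1]: one [#|'I_N|.+1] per level from [excess_step], and
   [1 + N] from the total sizes. *)
pose Cc := (\sum_i c i) * (#|'I_N|.+1)%:R + c0 * (1 + N%:R).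
have Cc0 : 0 <= Cc.
  by rewrite addr_ge0// mulr_ge0// ?sumr_ge0// addr_ge0.
pose e1 := e / (Cc + 1).
have e10 : 0 < e1 by rewrite divr_gt0// ltr_wpDl.
have Ce1 : Cc * e1 <= e.
  by rewrite mulrCA ler_piMr ?(ltW e0)// ler_pdivrMr ?mul1r ?lerDl// ltr_wpDl.
(* The errors [e2 * h] of single jobs add up to at most [e1 * h]. *)
pose e2 := e1 / (N%:R + 1).
have N1 : 0 < N%:R + 1 :> R by rewrite ltr_wpDl.
have e20 : 0 < e2 by rewrite divr_gt0.
have Ne2 : N%:R * e2 <= e1.
  by rewrite mulrCA ler_piMr ?(ltW e10)// ler_pdivrMr// mul1r lerDl.
have e21 : e2 <= e1 by rewrite ler_pdivrMr// ler_peMr ?(ltW e10)// lerDr.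
have [d d0 H] : exists2 d : R, 0 < d & forall j h, 0 < h -> h < d ->
    [/\ ~~ released t (t + h) j,
        (j \in S -> (V + 1) * h <= rem rA t j),
        `|incr (rA j) t (t + h) - rA j t * h| <= e2 * h &
        `|incr (rO j) t (t + h) - rO j t * h| <= e2 * h].
  apply: common_delta => j.
  have [d1 d10 H1] := dA j _ e20; have [d2 d20 H2] := dO j _ e20.
  (* [d3] ends the step before the release of [j], and [d4] before a served [j] runs out; [V + 1] is
     positive even for [V = 0]. *)
  pose d3 := if t < a j then a j - t else 1.
  pose d4 := if j \in S then rem rA t j / (V + 1) else 1.
  have V1 : 0 < V + 1 by rewrite ltr_wpDl.
  have d30 : 0 < d3 by rewrite /d3; case: ifP => //; rewrite subr_gt0.
  have d40 : 0 < d4.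
    rewrite /d4; case: ifP => // /(fintype.subsetP SU); rewrite inE => jU.
    by rewrite divr_gt0// lt_neqAle eq_sym jU rem_ge0.
  exists (Num.min (Num.min d1 d2) (Num.min d3 d4)); first by rewrite !lt_min d10 d20 d30.
  move=> h h0; rewrite !lt_min => /andP[/andP[hd1 hd2] /andP[hd3 hd4]]; split.
  - rewrite /released; apply/negP => /andP[ta]; apply/negP; rewrite -ltNge.
    by move: hd3; rewrite /d3 ta ltrBrDl.
  - by move=> jS; move: hd4; rewrite /d4 jS ltr_pdivlMr// mulrC => /ltW.
  - exact: H1.
  - exact: H2.
exists d => // h h0 hd.
have tth : t <= t + h by rewrite lerDl ltW.
(* Only work on unfinished jobs reduces the remaining sizes of the other schedule. *)
pose dd j := if j \in UO then incr (rO j) t (t + h) else 0.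
have inc0 j : 0 <= incr (rO j) t (t + h) by exact: incr_ge0.
have dd0 j : 0 <= dd j by rewrite /dd; case: ifP.
have pA j : rem rA (t + h) j <= rem rA t j.
  have := rem_le_released j okA tth; have [/negbTE-> _ _ _] := H j h h0 hd.
  by rewrite addr0.
have qO j : rem rO (t + h) j <= rem rO t j.
  have := rem_le_released j okO tth; have [/negbTE-> _ _ _] := H j h h0 hd.
  by rewrite addr0.
have qO0 j : rem rO t j = 0 -> rem rO (t + h) j = 0.
  by move=> q0; apply/eqP; rewrite eq_le rem_ge0 andbT -q0.
have qOd j : rem rO t j <= rem rO (t + h) j + dd j.
  have := released_le_rem j okO tth; have [/negbTE-> _ _ _] := H j h h0 hd.
  rewrite addr0 /dd inE; case: eqP => [->|_ //].
  by rewrite addr0 rem_ge0.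
have ddY : \sum_j dd j <= (Y + e1) * h.
  rewrite /dd -big_mkcond/= /Y.
  have : \sum_(j in UO) incr (rO j) t (t + h) <= \sum_(j in UO) (rO j t * h + e2 * h).
    apply: ler_sum => j _; have [_ _ _] := H j h h0 hd.
    by rewrite ler_norml => /andP[_]; rewrite lerBlDl.
  rewrite big_split/= -mulr_suml sumr_const -mulr_natl => /le_trans; apply.
  rewrite mulrDl lerD2l mulrA ler_pM2r// (le_trans _ Ne2)// ler_pM2r// ler_nat.
  by rewrite (leq_trans (max_card _))// card_ord.
have Srate j : j \in S -> rem rA (t + h) j <= rem rA t j - (V - e1) * h.
  move=> jS; have [/negbTE nr /(_ jS) hr Hd _] := H j h h0 hd.
  have jU : rem rA t j != 0 by have := fintype.subsetP SU j jS; rewrite inE.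
  move: Hd; rewrite incrNy// (SV _ jS) ler_norml => /andP[Hd _].
  move: hr jU; rewrite /rem; case: ifP => [at_ hr _|]; last by rewrite eqxx.
  rewrite (le_trans at_ tth).
  have Vh : (V - e1) * h <= (V + 1) * h by rewrite ler_pM2r//; lra.
  have e21h : e2 * h <= e1 * h by rewrite ler_pM2r.
  move: hr Hd; move: (\int[mu]_(_ in `]-oo, t]) _)%R (\int[mu]_(_ in `]-oo, t + h]) _)%R => x y.
  case: (leP 0 (w j - x)) => wx hr Hd.
    by rewrite ge_max; apply/andP; split; lra.
  have : 0 < (V + 1) * h by rewrite mulr_gt0// ltr_wpDl.
  by rewrite ltNge hr.
have Y0 : 0 <= Y by exact: sumr_ge0.
have K1 : \sum_i c i * excess i (rem rA (t + h)) (rem rO (t + h)) <=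
   \sum_i c i * excess i (rem rA t) (rem rO t) +
   (\sum_i c i * excess_rate m #|U| #|UO| Y V i + (\sum_i c i) * (#|'I_N|.+1)%:R * e1) * h.
  rewrite mulrDl [X in _ <= _ + (X + _)]mulr_suml -mulrA -mulrA mulr_suml -!big_split/=.
  apply: ler_sum => i _.
  rewrite -[c i * _ * h]mulrA -!mulrDr ler_wpM2l// mulrA -mulrDl.
  exact: (@excess_step R _ i m (rem rA t) (rem rO t) (rem rA (t + h)) (rem rO (t + h)) dd S Y V e1 h
    m0 Y0 V0 e10 h0 (rem_ge0 _ _) pA (rem_ge0 _ _) qO0 dd0 qOd ddY SU cS Smin Srate).
have K2 : \sum_j rem rA (t + h) j <= \sum_j rem rA t j - (minn m #|U|)%:R * V * h + N%:R * e1 * h.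
  rewrite [leLHS](bigID (mem S))/= [X in _ <= X - _ + _](bigID (mem S))/=.
  have k1 : \sum_(j | j \notin S) rem rA (t + h) j <= \sum_(j | j \notin S) rem rA t j by exact: ler_sum.
  have k2 : \sum_(j in S) rem rA (t + h) j <= \sum_(j in S) (rem rA t j - (V - e1) * h).
    exact: ler_sum.
  move: k2; rewrite sumrB sumr_const cS -mulr_natl.
  have : (minn m #|U|)%:R * (e1 * h) <= N%:R * (e1 * h).
    have mN : (minn m #|U| <= N)%N.
      by rewrite (leq_trans (geq_minr _ _))// (leq_trans (max_card _))// card_ord.
    by apply: ler_wpM2r; [rewrite mulr_ge0 ?ltW|rewrite ler_nat].
  lra.
have K3 : \sum_j rem rO t j <= \sum_j rem rO (t + h) j + (Y + e1) * h.
  rewrite (le_trans (ler_sum _ (fun j _ => qOd j)))// big_split/= lerD2l//.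
move: K1 K2 K3; rewrite /potential.
move: (\sum_i c i * excess i (rem rA (t + h)) (rem rO (t + h))).
move: (\sum_i c i * excess i (rem rA t) (rem rO t)).
move: (\sum_i c i * excess_rate _ _ _ _ _ _).
move: (\sum_j rem rA (t + h) j) (\sum_j rem rA t j).
move: (\sum_j rem rO (t + h) j) (\sum_j rem rO t j) => o1 o0 r1 r0 z p0 p1 K1 K2 K3.
have K4 : c0 * (r1 - o1) <=
    c0 * (r0 - o0 + (Y - (minn m #|U|)%:R * V) * h + (1 + N%:R) * e1 * h).
  by rewrite ler_wpM2l//; lra.
have K5 : Cc * e1 * h <= e * h by rewrite ler_pM2r.
by move: K5; rewrite /Cc; lra.
Qed.

End Trajectory.

(** * Schedules *)

Section Schedule.
Context {R : realType} {m N : nat}.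
Variables (P : R -> R) (a w : 'I_N -> R).
Variables (s : 'I_m -> R -> R) (asg : 'I_m -> R -> option 'I_N).
Hypothesis P_ge0 : forall x, 0 <= x -> 0 <= P x.
Hypothesis P_le : forall x y, 0 <= x -> x <= y -> P x <= P y.
Hypothesis Hs : feasible a s asg.
Notation mu := (@lebesgue_measure R).

Let s_ge0 k t : 0 <= s k t. Proof. by case: Hs. Qed.

Lemma asg_inj k k' t j : asg k t = Some j -> asg k' t = Some j -> k = k'.
Proof. by case: Hs => _ _ _ + _; apply. Qed.

Definition energy t := \sum_k P (s k t).

Lemma energy_ge0 t : 0 <= energy t.
Proof. by apply: sumr_ge0 => k _; exact: P_ge0. Qed.

Lemma measurable_energy : measurable_fun setT energy.
Proof.
apply: measurable_sum => k.
(* [P] is monotone only on nonnegative arguments; composed with [max 0] it is monotone everywhere,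
   hence measurable. *)
rewrite (_ : (fun t => P (s k t)) = (fun x => P (Num.max 0 x)) \o s k); last first.
  by apply/funext => t /=; rewrite max_r.
apply: measurableT_comp; last by case: Hs.
apply: nondecreasing_measurable => // x y xy.
apply: P_le; first by rewrite le_max lexx.
by rewrite ge_max !le_max lexx/= xy orbT.
Qed.

Lemma job_rate_mkcond j u :
  job_rate s asg j u = \sum_k (s k \_ [set t | asg k t = Some j]) u.
Proof.
rewrite /job_rate big_mkcond/=; apply: eq_bigr => k _; rewrite patchE.
by case: eqP => H; [rewrite mem_set|rewrite memNset].
Qed.

Lemma job_rate_ge0 j u : 0 <= job_rate s asg j u.
Proof. by apply: sumr_ge0. Qed.

Lemma job_rate_le j u : job_rate s asg j u <= \sum_k s k u.
Proof. by rewrite /job_rate big_mkcond/=; apply: ler_sum => k _; case: ifP. Qed.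

Lemma job_rate_served k j u : asg k u = Some j -> job_rate s asg j u = s k u.
Proof.
move=> kj; rewrite /job_rate (bigD1 k)/= ?kj ?eqxx// big1 ?addr0// => k' /andP[/eqP k'j].
by rewrite (asg_inj k'j kj) eqxx.
Qed.

Lemma job_rate_idle j u : (forall k, asg k u <> Some j) -> job_rate s asg j u = 0.
Proof. by move=> H; rewrite /job_rate big1// => k /eqP /H. Qed.

Lemma job_rate_before j u : u < a j -> job_rate s asg j u = 0.
Proof.
move=> ua; apply: job_rate_idle => k; case: Hs => _ _ _ _ H /H.
by rewrite leNgt ua.
Qed.

Lemma measurable_job_rate j : measurable_fun setT (job_rate s asg j).
Proof.
rewrite (_ : job_rate s asg j = fun u => \sum_k (s k \_ [set t | asg k t = Some j]) u); last first.
  by apply/funext => u; exact: job_rate_mkcond.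
apply: measurable_sum => k; have [_ ms masg _ _] := Hs.
apply/(measurable_restrictT _ (masg k j)); exact: measurable_funS (ms k).
Qed.

(** The work done never decreases, so the times from release to completion form an interval. *)
Lemma measurable_unfinished j : measurable [set t | unfinished a w s asg j t].
Proof.
apply: is_interval_measurable => x y /= /andP[ax Wx] /andP[ay Wy] z /andP[xz zy].
rewrite /unfinished (le_trans ax xz)/=; apply: le_lt_trans Wy.
apply: ge0_subset_integral => //.
- apply/measurable_EFinP; apply: measurable_funS (measurable_job_rate j) => //.
- by move=> u _; rewrite lee_fin job_rate_ge0.
- by apply: subset_itvl; rewrite bnd_simp.
Qed.

Lemma nunfE t : nunf a w s asg t = #|[set j | unfinished a w s asg j t]%SET|.
Proof. by apply: eq_card => j; rewrite !inE; apply/idP/idP; rewrite inE. Qed.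

Lemma nunf_sum t :
  (nunf a w s asg t)%:R = \sum_j \1_[set t | unfinished a w s asg j t] t :> R.
Proof.
rewrite nunfE -sum1_card natr_sum big_mkcond/=; apply: eq_bigr => j _.
by rewrite inE indicE; case: ifP => H; [rewrite mem_set|rewrite memNset//= H].
Qed.

Lemma measurable_nunf : measurable_fun setT (fun t => (nunf a w s asg t)%:R : R).
Proof.
rewrite (_ : (fun t => _) = fun t => \sum_j \1_[set t | unfinished a w s asg j t] t); last first.
  by apply/funext => t; exact: nunf_sum.
by apply: measurable_sum => j; apply: measurable_indic; exact: measurable_unfinished.
Qed.

Lemma nunf_le t : (nunf a w s asg t <= N)%N.
Proof. by rewrite (leq_trans (max_card _))// card_ord. Qed.

Variables (T0 T : R).
Hypothesis aT0 : forall j, T0 < a j.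

Lemma nunf_before t : t <= T0 -> nunf a w s asg t = 0%N.
Proof.
move=> tT0; rewrite nunfE; apply: eq_card0 => j; rewrite !inE /unfinished.
by rewrite leNgt (le_lt_trans tT0 (aT0 j)).
Qed.

Variable s1 : R.
Hypothesis Hs1 : forall x, 0 <= x -> x <= s1 * (1 + P x).
Hypothesis ienergy : mu.-integrable `[T0, T] (EFin \o energy).

(* A schedule may keep spending work on finished jobs, so that its rates need
   only be integrable up to a horizon [T]. *)
Definition trunc_rate (j : 'I_N) : R -> R := job_rate s asg j \_ `[T0, T].

Lemma integrable_trunc_rate j : mu.-integrable setT (EFin \o trunc_rate j).
Proof.
rewrite /trunc_rate -restrict_EFin; apply/integrable_restrict => //.
rewrite setTI.
have ig : mu.-integrable `[T0, T] (EFin \o (fun u => s1 * (m%:R + energy u))).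
  have ic : mu.-integrable `[T0, T] (EFin \o (fun=> m%:R : R)).
    by apply: (@integrable_bounded_itv _ _ _ _ `|m%:R|).
  by apply: integrable_mulr => //; exact: integrable_addr.
apply: le_integrable ig => //.
  by apply/measurable_EFinP; apply: measurable_funS (measurable_job_rate j).
move=> u _ /=; rewrite lee_fin ger0_norm ?job_rate_ge0//.
apply: le_trans (ler_norm _); rewrite (le_trans (job_rate_le j u))//.
rewrite (le_trans (ler_sum _ (fun k _ => Hs1 (s_ge0 k u))))// -mulr_sumr big_split/=.
by rewrite sumr_const card_ord.
Qed.

Lemma trunc_rate_ok : rates_ok a trunc_rate.
Proof.
split=> [j u|j|j u ua]; rewrite /trunc_rate ?patchE.
- by case: ifP => // _; exact: job_rate_ge0.
- exact: integrable_trunc_rate.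
- by rewrite job_rate_before// if_same.
Qed.

Lemma work_doneE j t : t <= T ->
  work_done s asg j t = (\int[mu]_(u in `]-oo, t]) trunc_rate j u)%R%:E.
Proof.
move=> tT; rewrite /work_done /Rintegral fineK; last first.
  by apply: integrable_fin_num => //; exact/integrable_sub/integrable_trunc_rate.
apply: eq_integral => u; rewrite inE/= in_itv/= => ut; congr EFin.
rewrite /trunc_rate patchE; case: ifPn => //; rewrite notin_setE/= in_itv/= (le_trans ut tT) andbT.
by move/negP; rewrite -ltNge => uT0; rewrite job_rate_before// (lt_trans uT0).
Qed.

Lemma unfinishedE j t : t <= T ->
  unfinished a w s asg j t = (rem a w trunc_rate t j != 0).
Proof.
move=> tT; rewrite /unfinished /rem work_doneE// lte_fin; case: ifP => //= _; last by rewrite eqxx.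
rewrite -subr_gt0; case: (ltP 0 (w j - _)) => H; first by rewrite gt_eqF.
by rewrite eqxx.
Qed.

Lemma rem_unfinished j t : t <= T -> unfinished a w s asg j t ->
  rem a w trunc_rate t j = w j - fine (work_done s asg j t).
Proof.
move=> tT /andP[at_]; rewrite /rem work_doneE// at_ lte_fin -subr_gt0 => H.
by rewrite max_r//= ltW.
Qed.

Lemma nunf_rem t : t <= T ->
  nunf a w s asg t = #|[set j | rem a w trunc_rate t j != 0]%SET|.
Proof. by move=> tT; rewrite nunfE; apply: eq_card => j; rewrite !inE unfinishedE. Qed.

End Schedule.

(** Intermediate value theorem between the minimum and the maximum of [s1] and [s1 * v]: as
    [P x / x] is nondecreasing and [P s1 = 1], the values of [P] there enclose [v]. This provides
    the speeds [Q i]. *)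
Lemma power_surj (R : realType) (P : R -> R) (s1 v : R) : P 0 = 0 ->
  (forall x, 0 < x -> derivable P x 1) ->
  (forall x y, 0 <= x -> x <= y -> P x * y <= x * P y) ->
  0 < s1 -> P s1 = 1 -> 0 <= v -> exists2 x, 0 <= x & P x = v.
Proof.
move=> P0 Pd star s10 Ps1; rewrite le_eqVlt => /predU1P[<-|v0].
  by exists 0.
pose x := Num.min s1 (s1 * v); pose y := Num.max s1 (s1 * v).
have x0 : 0 < x by rewrite lt_min s10 mulr_gt0.
have xs : x <= s1 by rewrite ge_min lexx.
have sy : s1 <= y by rewrite le_max lexx.
have Px : P x <= v.
  have := star _ _ (ltW x0) xs; rewrite Ps1 mulr1 -ler_pdivlMr// => /le_trans; apply.
  by rewrite ler_pdivrMr// ge_min mulrC lexx orbT.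
have Py : v <= P y.
  have := star _ _ (ltW s10) sy; rewrite Ps1 mul1r => H.
  by rewrite -(ler_pM2l s10) (le_trans _ H)// le_max lexx orbT.
have xy : x <= y by exact: le_trans sy.
have [||c] := @IVT R P x y v xy.
- apply: derivable_within_continuous => z; rewrite in_itv/= => /andP[xz _].
  by apply: Pd; exact: lt_le_trans xz.
- by rewrite ge_min Px le_max Py orbT.
rewrite in_itv/= => /andP[xc _] Pc; exists c => //.
by rewrite ltW// (lt_le_trans x0).
Qed.

(** * Speed spent on unfinished jobs *)

Section ServedRates.
Context {R : realType} {m N : nat}.
Variables (P : R -> R) (a w : 'I_N -> R).
Variables (s : 'I_m -> R -> R) (asg : 'I_m -> R -> option 'I_N).
Hypothesis P0 : P 0 = 0.
Hypothesis P_ge0 : forall x, 0 <= x -> 0 <= P x.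
Hypothesis Hs : feasible a s asg.

(** Work wasted on finished jobs is left out, so that at most as many speeds are nonzero as there
    are unfinished jobs, as the drift inequality requires. *)
Definition useful_speed t (k : 'I_m) : R :=
  if asg k t is Some j then if unfinished a w s asg j t then s k t else 0 else 0.

Lemma useful_speed_ge0 t k : 0 <= useful_speed t k.
Proof.
rewrite /useful_speed; case: (asg k t) => // j; case: ifP => // _.
by case: Hs.
Qed.

Lemma useful_speed_energy t : \sum_k P (useful_speed t k) <= energy P s t.
Proof.
have s0 k : 0 <= s k t by case: Hs.
apply: ler_sum => k _; rewrite /useful_speed; case: (asg k t) => [j|].
  by case: ifP => // _; rewrite P0 P_ge0.
by rewrite P0 P_ge0.
Qed.

Lemma sum_useful_speed t :
  \sum_(j in [set j | unfinished a w s asg j t]%SET) job_rate s asg j t =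
  \sum_k useful_speed t k.
Proof.
rewrite /job_rate (exchange_big_dep xpredT)//=; apply: eq_bigr => k _.
rewrite /useful_speed; case E : (asg k t) => [j|]; last by rewrite big_pred0// => i; rewrite andbF.
case: ifPn => Uj.
  rewrite (big_pred1 j)// => i /=; rewrite inE (inj_eq Some_inj) eq_sym.
  by case: eqP => [->|]; rewrite ?Uj ?andbF.
rewrite big_pred0// => i; rewrite inE (inj_eq Some_inj).
by case: eqP => [<-|]; rewrite ?andbF// (negbTE Uj).
Qed.

Lemma card_useful_speed t :
  (#|[pred k | useful_speed t k != 0%R]| <= nunf a w s asg t)%N.
Proof.
rewrite nunfE -(card_imset _ Some_inj).
rewrite -(card_in_imset (f := fun k => asg k t)); last first.
  move=> k k'; rewrite !inE /useful_speed.
  case E : (asg k t) => [j|]; last by rewrite eqxx.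
  by move=> _ _ E'; apply: (asg_inj Hs E).
apply/subset_leq_card/fintype.subsetP => o /imsetP[k]; rewrite inE /useful_speed => + ->.
case: (asg k t) => [j|]; last by rewrite eqxx.
case: ifP => Uj; last by rewrite eqxx.
by move=> _; apply: imset_f; rewrite inE.
Qed.

End ServedRates.

(** * Served jobs and energy of the algorithm *)

Section SRPT.
Context {R : realType} {m N : nat}.
Variables (P : R -> R) (a w : 'I_N -> R).
Variables (s : 'I_m -> R -> R) (asg : 'I_m -> R -> option 'I_N).
Hypothesis m0 : (0 < m)%N.
Hypothesis P0 : P 0 = 0.
Hypothesis HA : srpt_alg P a w s asg.

Definition served t : {set 'I_N} := [set j | [exists k, asg k t == Some j]]%SET.

Lemma servedP t j : reflect (exists k, asg k t = Some j) (j \in served t).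
Proof. by rewrite inE; apply: (iffP existsP) => -[k /eqP]; exists k => //; apply/eqP. Qed.

Lemma card_served t : #|served t| = minn m (nunf a w s asg t).
Proof.
have [_ /(_ t)[_ <- _ _ _]] := HA.
by apply: eq_card => j; rewrite !inE; apply/idP/idP; rewrite inE.
Qed.

(** Either [m] servers use power [n / m] each, or [n < m] servers use power [1] each. *)
Lemma srpt_energy t : energy P s t = (nunf a w s asg t)%:R.
Proof.
have [Hf /(_ t)] := HA; set n := nunf _ _ _ _ _ => -[_ _ _ Hidle Hbusy].
pose K := [set k | asg k t != None]%SET.
have cK : #|K| = minn m n.
  rewrite -card_served -[RHS](card_imset _ Some_inj) -[LHS](card_in_imset (f := fun k => asg k t)).
    apply: eq_card => o; apply/imsetP/imsetP => -[].
      move=> k; rewrite inE; case E : (asg k t) => [j|]// _ ->; exists j => //.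
      by apply/servedP; exists k.
    by move=> j /servedP[k kj] ->; exists k; rewrite ?inE ?kj.
  move=> k k'; rewrite !inE; case E : (asg k t) => [j|]// _ _ E'.
  exact: (asg_inj Hf E).
rewrite /energy (bigID (mem K))/= [X in _ + X]big1 ?addr0; last first.
  by move=> k; rewrite inE negbK => /eqP /Hidle ->.
rewrite (eq_bigr (fun=> if (m <= n)%N then n%:R / m%:R else 1)); last first.
  by move=> k; rewrite inE; case E : (asg k t) => [j|]// _; exact: Hbusy E.
rewrite sumr_const cK; case: leqP => mn; last by [].
by rewrite -[_ *+ m]mulr_natr divfK// pnatr_eq0 -lt0n.
Qed.

End SRPT.

(** * Competitiveness *)

Section Competitive.
Context {R : realType} {m N : nat}.
Variables (P : R -> R) (a w : 'I_N -> R) (s1 : R).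
Hypothesis m0 : (0 < m)%N.
Hypothesis w0 : forall j, 0 < w j.
Hypothesis P0 : P 0 = 0.
Hypothesis P_diff : forall x, 0 < x -> derivable P x 1.
Hypothesis P_incr : forall x y, 0 <= x -> x < y -> P x < P y.
Hypothesis P_sconv : forall x y l, 0 <= x -> 0 <= y -> x != y -> 0 < l -> l < 1 ->
      P (l * x + (1 - l) * y) < l * P x + (1 - l) * P y.
Hypothesis P_submult : forall x y, 0 < x -> 0 < y -> P (x * y) <= P x * P y.
Hypotheses (Hs1 : 0 <= s1) (Ps1 : P s1 = 1).
Variables (sA : 'I_m -> R -> R) (asgA : 'I_m -> R -> option 'I_N).
Hypothesis HA : srpt_alg P a w sA asgA.
Variables (s : 'I_m -> R -> R) (asg : 'I_m -> R -> option 'I_N).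
Hypothesis Hs : feasible a s asg.
Notation mu := (@lebesgue_measure R).
Notation nA t := ((nunf a w sA asgA t)%:R : R).
Notation nO t := ((nunf a w s asg t)%:R : R).

Let HfA : feasible a sA asgA. Proof. by case: HA. Qed.
Let Pge0 := power_ge0 P0 P_incr.
Let Ple := power_le P_incr.
Let s10 : 0 < s1 := power_s1_gt0 P0 Hs1 Ps1.

Let K : R := P (2 - m%:R^-1) * (1 + s1^-1).

(** [potential_dini] expresses the drift by excess rates, and [drift_weights] bounds it pointwise,
    with the useful speeds of the other schedule as [y]. *)
Lemma potential_drift (T0 T : R) : (forall j, T0 < a j) ->
  mu.-integrable `[T0, T] (EFin \o energy P sA) ->
  mu.-integrable `[T0, T] (EFin \o energy P s) ->
  let rA := trunc_rate sA asgA T0 T in let rO := trunc_rate s asg T0 T in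
  exists c : 'I_N -> R, (forall i, 0 <= c i) /\
  forall t, T0 < t -> t < T ->
  (forall j, has_density (rA j) (rA j t) t) ->
  (forall j, has_density (rO j) (rO j t) t) ->
  forall e, 0 < e -> exists2 d, 0 < d & forall h, 0 < h -> h < d ->
    potential a w rA rO c s1^-1 (t + h) - potential a w rA rO c s1^-1 t <=
    (K * (nO t + energy P s t) - nA t + e) * h.
Proof.
move=> aT0 iA iO rA rO.
have speed x : 0 <= x -> x <= s1 * (1 + P x).
  move=> x0; rewrite (le_trans (speed_le P0 P_incr P_sconv Hs1 Ps1 x0))//.
  by rewrite ler_pM2l// lerD2r lern1 leq_b1.
have okA : rates_ok a rA := trunc_rate_ok HfA speed iA.
have okO : rates_ok a rO := trunc_rate_ok Hs speed iO.
have s1V0 : 0 <= s1^-1 by rewrite invr_ge0.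
have star := power_star P0 P_sconv.
have surj i : exists x : R, 0 <= x /\ P x = i%:R / m%:R.
  have v0 : 0 <= i%:R / m%:R :> R by rewrite divr_ge0.
  by have [x x0 Px] := power_surj P0 P_diff star s10 Ps1 v0; exists x.
have /choice[Q QP] := surj.
have [c [c0 Hc]] := drift_weights N P0 P_incr P_sconv P_submult Hs1 Ps1 m0
   (fun i => (QP i).1) (fun i => (QP i).2).
exists c; split=> // t T0t tT dA dO e e0.
have tT' := ltW tT.
pose n := nunf a w sA asgA t.
pose V := if (m <= n)%N then Q n else s1.
have V0 : 0 <= V by rewrite /V; case: ifP => // _; exact: (QP n).1.
have PV : P V = if (m <= n)%N then n%:R / m%:R else 1.
  by rewrite /V; case: ifP => // _; exact: (QP n).2.
have [_ /(_ t)] := HA; rewrite -/n => -[Hserv _ Hsrpt _ Hspeed].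
pose U := [set j | rem a w rA t j != 0]%SET.
pose UO := [set j | rem a w rO t j != 0]%SET.
have nU : #|U| = n by rewrite /n (nunf_rem w HfA aT0 speed iA).
have nUO : #|UO| = nunf a w s asg t by rewrite (nunf_rem w Hs aT0 speed iO).
have SU : (served asgA t \subset U)%SET.
  apply/fintype.subsetP => j /servedP[k kj]; rewrite inE -(unfinishedE w HfA aT0 speed iA)//.
  by apply: Hserv; apply/existsP; exists k; rewrite kj.
have cS : #|served asgA t| = minn m #|U| by rewrite nU (card_served HA).
have Smin x y : x \in served asgA t -> y \in U -> y \notin served asgA t ->
    rem a w rA t x <= rem a w rA t y.
  move=> xS yU yS; have xU := fintype.subsetP SU _ xS.
  rewrite !inE -!(unfinishedE w HfA aT0 speed iA)// in xU yU.
  rewrite !(rem_unfinished HfA aT0 speed iA)//.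
  rewrite !inE in xS yS.
  have := Hsrpt x y xS yU yS.
  by rewrite !(work_doneE HfA aT0 speed iA)//= lee_fin.
have T0T : T0 <= t <= T by rewrite !ltW.
have SV j : j \in served asgA t -> rA j t = V.
  move=> /servedP[k kj].
  rewrite /rA /trunc_rate patchE mem_set/= ?in_itv//= (job_rate_served HfA kj).
  apply: (power_inj P_incr) => //; first by case: HfA.
  by rewrite (Hspeed _ _ kj) PV.
have YE : \sum_(j in UO) rO j t = \sum_k useful_speed a w s asg t k.
  rewrite -sum_useful_speed; apply: eq_big => j.
    by rewrite !inE (unfinishedE w Hs aT0 speed iO).
  by move=> _; rewrite /rO /trunc_rate patchE mem_set//= in_itv.
have [d d0 Hd] := potential_dini w0 okA okO c0 s1V0
  m0 dA dO V0 SU cS Smin SV e0.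
exists d => // h h0 hd; rewrite (le_trans (Hd h h0 hd))// ler_pM2r// lerD2r.
rewrite -/U -/UO nU nUO YE.
have nN : (n <= N)%N by exact: nunf_le.
rewrite (le_trans (Hc _ _ _ _ nN (useful_speed_ge0 w Hs t) (card_useful_speed w Hs t) V0 PV))//.
rewrite lerD2r ler_wpM2l//.
  rewrite mulr_ge0 ?addr_ge0 ?invr_ge0// Pge0//.
  have : (m%:R : R)^-1 <= 1 by rewrite invf_le1 ?ltr0n// ler1n.
  lra.
by rewrite lerD2l; exact: useful_speed_energy.
Qed.

(** The potential is zero at [T0], before all releases, and nonnegative at [T], where the other
    schedule has finished, so its drift bound has a nonnegative integral. *)
Lemma flow_horizon (T0 T : R) : T0 <= T -> (forall j, T0 < a j) ->
  mu.-integrable setT (EFin \o energy P s) ->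
  (forall j, ~~ unfinished a w s asg j T) ->
  (\int[mu]_(t in `]T0, T]) (nA t)%:E <=
    K%:E * (\int[mu]_(t in `]T0, T]) (nO t)%:E + \int[mu]_(t in `]T0, T]) (energy P s t)%:E))%E.
Proof.
move=> T0T aT0 iE fin.
have inA : mu.-integrable `[T0, T] (EFin \o (fun t => nA t)).
  apply: (@integrable_bounded_itv _ _ _ _ N%:R); first exact: measurable_nunf.
  by move=> t; rewrite ger0_norm// ler_nat nunf_le.
have inO : mu.-integrable `[T0, T] (EFin \o (fun t => nO t)).
  apply: (@integrable_bounded_itv _ _ _ _ N%:R); first exact: measurable_nunf.
  by move=> t; rewrite ger0_norm// ler_nat nunf_le.
(* The power of the algorithm equals its number of jobs, which is at most [N]. *)
have iEA : mu.-integrable `[T0, T] (EFin \o energy P sA).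
  by rewrite (_ : energy P sA = fun t => nA t)//; apply/funext => t; exact: srpt_energy.
have iEO : mu.-integrable `[T0, T] (EFin \o energy P s) by exact: integrable_sub.
have [c [c0 Hdini]] := potential_drift aT0 iEA iEO.
set rA := trunc_rate sA asgA T0 T in Hdini; set rO := trunc_rate s asg T0 T in Hdini.
have speed x : 0 <= x -> x <= s1 * (1 + P x).
  move=> x0; rewrite (le_trans (speed_le P0 P_incr P_sconv Hs1 Ps1 x0))//.
  by rewrite ler_pM2l// lerD2r lern1 leq_b1.
have okA : rates_ok a rA := trunc_rate_ok HfA speed iEA.
have okO : rates_ok a rO := trunc_rate_ok Hs speed iEO.
pose f t := K * (nO t + energy P s t) - nA t.
have iOE : mu.-integrable `[T0, T] (EFin \o (fun t => nO t + energy P s t)).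
  exact: integrable_addr.
have iK : mu.-integrable `[T0, T] (EFin \o (fun t => K * (nO t + energy P s t))).
  exact: integrable_mulr.
have if_ : mu.-integrable `[T0, T] (EFin \o f) by exact: integrable_subr.
pose r := f \_ `[T0, T].
have ir : mu.-integrable setT (EFin \o r).
  by rewrite /r -restrict_EFin; apply/integrable_restrict => //; rewrite setTI.
pose rho t := (\sum_i c i + s1^-1) * \sum_j rO j t.
have [_ irA _] := okA; have [rO0 irO _] := okO.
have isum : mu.-integrable setT (EFin \o (fun t => \sum_j rO j t)) by exact: integrable_Rsum.
have cs0 : 0 <= \sum_i c i + s1^-1 by rewrite addr_ge0 ?sumr_ge0 ?invr_ge0.
have irho : mu.-integrable setT (EFin \o rho) by exact: integrable_mulr.
have rho0 t : 0 <= rho t by rewrite mulr_ge0// sumr_ge0.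
have ae1 := filter_forall (ae_filter_ringOfSetsType mu) (fun j => ae_density (irA j)).
have ae2 := filter_forall (ae_filter_ringOfSetsType mu) (fun j => ae_density (irO j)).
have Hmain : potential a w rA rO c s1^-1 T - potential a w rA rO c s1^-1 T0 <= incr r T0 T.
  apply: (le_incr_dini T0T irho ir rho0).
    move=> x y _ xy _; apply: potential_incr => //.
    by rewrite invr_ge0.
  apply: (@filterS2 _ _ (ae_filter_ringOfSetsType mu) _ _ _ _ ae1 ae2) => t dA dO T0t tT e e0.
  rewrite /r patchE mem_set/= ?in_itv/= ?(ltW T0t) ?(ltW tT)//.
  exact: Hdini.
have remT0 r' : rem a w r' T0 = fun=> 0.
  by apply/funext => j; rewrite /rem leNgt aT0.
have pot0 : potential a w rA rO c s1^-1 T0 = 0.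
  have ds0 k : drop_sum k (fun=> 0 : R) = 0 :> R by rewrite /drop_sum big1.
  have ex0 (i : 'I_N) : @excess R 'I_N i (fun=> 0) (fun=> 0) = 0.
    apply/eqP; rewrite eq_le excess_ge0 andbT; apply: excess_le => // k _.
    by rewrite !ds0 subrr.
  rewrite /potential !remT0 big1 => [|i _]; last by rewrite ex0 mulr0.
  by rewrite subrr mulr0 addr0.
have potT : 0 <= potential a w rA rO c s1^-1 T.
  rewrite /potential addr_ge0//.
    by apply: sumr_ge0 => i _; rewrite mulr_ge0// excess_ge0.
  have remO0 j : rem a w rO T j = 0.
    by apply/eqP; have := fin j; rewrite (unfinishedE w Hs aT0 speed iEO)// negbK.
  rewrite [X in _ - X]big1// subr0 mulr_ge0 ?invr_ge0// sumr_ge0// => j _.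
  exact: rem_ge0.
have sub : `]T0, T] `<=` `[T0, T] by exact: subset_itv_oc_cc.
have iS g : mu.-integrable `[T0, T] (EFin \o g) -> mu.-integrable `]T0, T] (EFin \o g).
  by move=> ig; exact: integrableS ig.
have : 0 <= incr r T0 T by rewrite (le_trans _ Hmain)// pot0 subr0.
have -> : incr r T0 T = (\int[mu]_(t in `]T0, T]) f t)%R.
  by apply: eq_Rintegral => t; rewrite inE => /sub tT; rewrite /r patchE mem_set.
rewrite /f RintegralB//; [|exact: iS..].
rewrite RintegralZl//; last exact: iS.
rewrite RintegralD//; [|exact: iS..].
have fA : (\int[mu]_(t in `]T0, T]) (nA t)%:E)%E \is a fin_num.
  by apply: integrable_fin_num; [exact: measurable_itv|exact: iS inA].
have fO : (\int[mu]_(t in `]T0, T]) (nO t)%:E)%E \is a fin_num.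
  by apply: integrable_fin_num; [exact: measurable_itv|exact: iS inO].
have fE : (\int[mu]_(t in `]T0, T]) (energy P s t)%:E)%E \is a fin_num.
  by apply: integrable_fin_num; [exact: measurable_itv|exact: iS iEO].
by rewrite subr_ge0 -(fineK fA) -(fineK fO) -(fineK fE) -EFinD -EFinM lee_fin.
Qed.

(** Finished jobs stay finished, and a job never finished would contribute infinite flow time. *)
Lemma flow_finishes : (\int[mu]_(t in [set: R]) (nO t)%:E < +oo)%E ->
  exists T1, forall j t, T1 <= t -> ~~ unfinished a w s asg j t.
Proof.
move=> fin.
have mono j t t' : a j <= t -> t <= t' -> ~~ unfinished a w s asg j t ->
    ~~ unfinished a w s asg j t'.
  move=> at_ tt'; rewrite /unfinished at_ (le_trans at_ tt')/= -!leNgt => /le_trans; apply.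
  apply: ge0_subset_integral => //.
  - by apply/measurable_EFinP; apply: measurable_funS (measurable_job_rate Hs j).
  - by move=> u _; rewrite lee_fin (job_rate_ge0 Hs).
  - by apply: subset_itvl; rewrite bnd_simp.
have ex j : exists t, a j <= t /\ ~~ unfinished a w s asg j t.
  apply: contrapT => H.
  have unf t : a j <= t -> unfinished a w s asg j t.
    by move=> at_; apply: contrapT => /negP ?; apply: H; exists t.
  have I0 : (0 <= \int[mu]_(t in [set: R]) (nO t)%:E)%E by apply: integral_ge0.
  have : (\int[mu]_(t in [set: R]) (nO t)%:E)%E \is a fin_num by rewrite ge0_fin_numE.
  move/fineK; set F := fine _ => FE.
  have F0 : 0 <= F by rewrite fine_ge0.
  have mn : measurable_fun setT (EFin \o (fun t => nO t)).
    by apply/measurable_EFinP; exact: measurable_nunf.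
  have : (\int[mu]_(t in `[a j, (a j + (F + 1))%R]) (cst 1%E t) <= \int[mu]_(t in [set: R]) (nO t)%:E)%E.
    apply: (@le_trans _ _ (\int[mu]_(t in `[a j, (a j + (F + 1))%R]) (nO t)%:E)%E).
      apply: ge0_le_integral => //; first exact: measurable_funS mn.
      move=> t; rewrite /= in_itv/= => /andP[at_ _]; rewrite lee_fin ler1n nunfE card_gt0.
      by apply/set0Pn; exists j; rewrite inE unf.
    exact: ge0_subset_integral.
  rewrite integral_cst// mul1e [X in (X <= _)%E](lebesgue_measure_itv `[a j, a j + (F + 1)])/=.
  rewrite lte_fin ltrDl (_ : 0 < F + 1); last by lra.
  by rewrite -FE -EFinB lee_fin; lra.
have /choice[t tP] := ex.
exists (\big[Num.max/0]_j t j) => j u tu; have [at_ ut] := tP j.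
apply: mono at_ _ ut; apply: le_trans tu; exact: le_bigmax_cond.
Qed.

Lemma flow_competitive : (cost P a w s asg < +oo)%E ->
  (\int[mu]_(t in [set: R]) (nA t)%:E <= K%:E * cost P a w s asg)%E.
Proof.
rewrite /cost => fin.
have mnA : measurable_fun setT (EFin \o (fun t => nA t)).
  by apply/measurable_EFinP; exact: measurable_nunf.
have mnO : measurable_fun setT (EFin \o (fun t => nO t)).
  by apply/measurable_EFinP; exact: measurable_nunf.
have mE : measurable_fun setT (EFin \o energy P s).
  by apply/measurable_EFinP; exact: (measurable_energy Ple Hs).
have E0 t : (0 <= (energy P s t)%:E)%E.
  by rewrite lee_fin (energy_ge0 Pge0 Hs).
have IO : (0 <= \int[mu]_(t in [set: R]) (nO t)%:E)%E by exact: integral_ge0.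
have IE : (0 <= \int[mu]_(t in [set: R]) (energy P s t)%:E)%E by exact: integral_ge0.
have finO : (\int[mu]_(t in [set: R]) (nO t)%:E < +oo)%E.
  exact: (le_lt_trans (leeDl _ IE) fin).
have finE : (\int[mu]_(t in [set: R]) (energy P s t)%:E < +oo)%E.
  exact: (le_lt_trans (leeDr _ IO) fin).
have iE : mu.-integrable setT (EFin \o energy P s).
  apply/integrableP; split=> //; under eq_integral do rewrite /= ger0_norm ?(energy_ge0 Pge0 Hs)//.
  exact: finE.
pose T0 := \big[Num.min/0]_j a j - 1.
have aT0 j : T0 < a j.
  have : \big[Num.min/0]_i a i <= a j by exact: bigmin_le_cond.
  rewrite /T0; lra.
have [T1 T1P] := flow_finishes finO.
(* Up to [T0] nothing is released, and each window ends after the other schedule has finished. The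
   limit is taken because no finishing time of the algorithm is known beforehand. *)
pose F i := `]T0, (Num.max T0 T1 + i%:R)%R]%classic.
have -> : (\int[mu]_(t in [set: R]) (nA t)%:E = \int[mu]_(t in \bigcup_i F i) (nA t)%:E)%E.
  rewrite [RHS]integral_mkcond; apply: eq_integral => t _; rewrite patchE; case: ifPn => //.
  rewrite notin_setE => tF; rewrite (nunf_before w sA asgA aT0)//.
  rewrite leNgt; apply/negP => T0t; apply: tF.
  exists (Num.truncn `|t - Num.max T0 T1|).+1 => //; rewrite /F /= in_itv/= T0t/=.
  rewrite -lerBlDl (le_trans (ler_norm _))// ltW//.
  by rewrite truncnS_gt.
have /cvg_lim <- // : (\int[mu]_(t in F i) (nA t)%:E)%E @[i --> \oo] -->
    (\int[mu]_(t in \bigcup_i F i) (nA t)%:E)%E.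
  apply: ge0_nondecreasing_set_cvg_integral => //.
  - move=> i j ij; apply/subsetPset; apply: subset_itvl; rewrite bnd_simp lerD2l ler_nat//.
  - by move=> i; exact: measurable_itv.
  - by move=> i; exact: measurable_funS mnA.
apply: lime_le.
  apply: ereal_nondecreasing_is_cvgn => i j ij; apply: ge0_subset_integral => //;
    [exact: measurable_itv|exact: measurable_itv|exact: measurable_funS mnA|].
  by apply: subset_itvl; rewrite bnd_simp lerD2l ler_nat.
apply: nearW => i.
have K0 : 0 <= K.
  rewrite mulr_ge0 ?addr_ge0 ?invr_ge0// Pge0//.
  have : (m%:R : R)^-1 <= 1 by rewrite invf_le1 ?ltr0n// ler1n.
  lra.
apply: (le_trans (flow_horizon _ aT0 iE _)).
- by rewrite (@le_trans _ _ (Num.max T0 T1)) ?le_max ?lexx// lerDl.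
- by move=> j; apply: T1P; rewrite (@le_trans _ _ (Num.max T0 T1)) ?le_max ?lexx ?orbT// lerDl.
apply: lee_wpmul2l; first by rewrite lee_fin.
by apply: leeD; apply: ge0_subset_integral => //; exact: measurable_itv.
Qed.

End Competitive.

Theorem theorem1 (R : realType) (P : R -> R) (m N : nat)
  (a w : 'I_N -> R)
  (Hm : (0 < m)%N)
  (Hw : forall j, 0 < w j)
  (* (A1) *)
  (P_nonneg : forall x, 0 <= x -> 0 <= P x)
  (P0 : P 0 = 0)
  (P_diff : forall x, 0 < x -> derivable P x 1)
  (P_diff0 : cvg ((fun h => (P h - P 0) / h) @ 0^'+))
  (P_incr : forall x y, 0 <= x -> x < y -> P x < P y)
  (P_sconv : forall x y l, 0 <= x -> 0 <= y -> x != y -> 0 < l -> l < 1 ->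
      P (l * x + (1 - l) * y) < l * P x + (1 - l) * P y)
  (sbar_fin : [set x : R | 0 < x /\ x < P x] !=set0)
  (* (A2) *)
  (P_submult : forall x y, 0 < x -> 0 < y -> P (x * y) <= P x * P y)
  (* s1 = P^{-1}(1) *)
  (s1 : R) (Hs1 : 0 <= s1) (Ps1 : P s1 = 1)
  (* any schedule produced by the online algorithm *)
  (sA : 'I_m -> R -> R) (asgA : 'I_m -> R -> option 'I_N)
  (HA : srpt_alg P a w sA asgA)
  (* any feasible (offline) schedule; OPT is the infimum of their costs *)
  (s : 'I_m -> R -> R) (asg : 'I_m -> R -> option 'I_N)
  (Hs : feasible a s asg) :
  (cost P a w sA asgA <=
    (P (2 - m%:R^-1) * (2 + 2 / s1 * Num.max 1 (P (sbar P))))%:E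
      * cost P a w s asg)%E.

Proof.
have s10 := power_s1_gt0 P0 Hs1 Ps1.
have HfA : feasible a sA asgA by case: HA.
have b0 : 0 < 2 - m%:R^-1 :> R.
  have : (m%:R : R)^-1 <= 1 by rewrite invf_le1 ?ltr0n// ler1n.
  lra.
have B0 := power_gt0 P0 P_incr b0.
set M := Num.max 1 (P (sbar P)).
have M1 : 1 <= M by rewrite le_max lexx.
have c0 : 0 < P (2 - m%:R^-1) * (2 + 2 / s1 * M).
  by rewrite mulr_gt0// addr_gt0// !mulr_gt0 ?invr_gt0//; lra.
have cost0 : (0 <= cost P a w s asg)%E.
  rewrite /cost adde_ge0// integral_ge0// => t _; rewrite lee_fin sumr_ge0// => k _.
  by apply: P_nonneg; case: Hs.
have [fin|] := ltP (cost P a w s asg) +oo%E; last first.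
  by rewrite leye_eq => /eqP ->; rewrite gt0_muley ?leey// lte_fin.
have -> : cost P a w sA asgA = (2%:E * \int[@lebesgue_measure R]_(t in [set: R]) ((nunf a w sA asgA t)%:R)%:E)%E.
  rewrite /cost [X in (_ + X)%E](_ : _ = \int[@lebesgue_measure R]_(t in [set: R]) ((nunf a w sA asgA t)%:R)%:E)%E.
    by rewrite -[2%:E]/((1 + 1)%:E) EFinD ge0_muleDl ?lee_fin// !mul1e.
  by apply: eq_integral => t _; rewrite -(srpt_energy Hm P0 HA).
have H := flow_competitive Hm Hw P0 P_diff P_incr P_sconv P_submult Hs1 Ps1 HA Hs fin.
apply: (le_trans (lee_wpmul2l _ H)) => //.
rewrite muleA -EFinM; apply: lee_wpmul2r => //; rewrite lee_fin.
(* The factor [2] for flow plus energy gives [2 * (1 + 1 / s1)] times the value of [P], and [M >= 1]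
   concludes. *)
rewrite mulrCA ler_pM2l// mulrDr mulr1 lerD2l -[leLHS]mulr1 ler_pM2l// mulr_gt0// invr_gt0//.
Qed.
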